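(* Let $n\geq1$ and $d\in\mathbb{N}$. Then $$\widetilde{g_n^d}=\begin{cases}-\delta(A)\,g_n^d & \text{if } d \text{ is odd},\\ \{-1\}^{n-1}\,g_n^{d-1} & \text{if } d \text{ is even},\end{cases}$$ with the convention $g_n^{-1}=0$.
   Context: Setting. $k$ is a field of characteristic $\neq 2$; $K,L$ denote field extensions of $k$. Quadratic forms are nondegenerate. $GW(K)$, $W(K)$ are the Grothendieck–Witt and Witt rings; $\hat I(K)\subset GW(K)$ is the ideal of elements of virtual dimension $0$ and $I(K)\subset W(K)$ the fundamental ideal; the projection $\hat I(K)\to I(K)$ is an isomorphism, and $\hat I^n(K)$ and $I^n(K)$ are identified. $\langle\langle a\rangle\rangle=\langle1\rangle-\langle a\rangle\in\hat I(K)$, $\langle\langle a_1,\dots,a_n\rangle\rangle=\prod\langle\langle a_i\rangle\rangle$, and $\mathrm{Pf}_n(K)$ is the set of these $n$-fold Pfister elements. For functors $F$ (to sets) and $H$ (to abelian groups) on field extensions of $k$, $\mathrm{Inv}(F,H)$ is the group of natural transformations $F\to H$. $A$ is a functor from field extensions of $k$ to filtered commutative rings $A(K)=A^0(K)\supset A^1(K)\supset\cdots$, with $\bigcap_nA^n(K)=0$, together with a natural map $f_1:I(K)\to A^1(K)$ such that: (i) $\langle\langle a_1,\dots,a_n\rangle\rangle\mapsto\{a_1,\dots,a_n\}:=f_1(\langle\langle a_1\rangle\rangle)\cdots f_1(\langle\langle a_n\rangle\rangle)$ is a well-defined injective map $\mathrm{Pf}_n(K)\to A^n(K)$; (ii)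 for all $n\geq1$ this map extends to a group morphism $f_n:I^n(K)\to A^n(K)$; (iii) if $x\in A(K)$ satisfies $\{a\}\cdot x\in A^{d+1}(L)$ for all extensions $L/K$ and all $a\in L^*$, then $x\in A^d(K)$; (iv) for all $K$ and $n\geq 1$, every invariant of $\mathrm{Pf}_n$ over $K$ (i.e. on extensions of $K$) with values in $A$ is uniquely of the form $x+y f_n$ with $x,y\in A(K)$. (Examples: $A=W$ with $f_1=\mathrm{Id}$; $A=H^*(-,\mu_2)$ with $f_1=e_1$.) Put $M=\mathrm{Inv}(I^n,A)$. For $\varepsilon=\pm1$ there is a unique operator $\alpha\mapsto\alpha^\varepsilon$ on $M$ with $\alpha(q+\varepsilon\varphi)=\alpha(q)+\varepsilon f_n(\varphi)\alpha^\varepsilon(q)$ for all $K$, $q\in I^n(K)$, $\varphi\in\mathrm{Pf}_n(K)$; write $\alpha^+,\alpha^-$. The invariants $g_n^d\in\mathrm{Inv}(I^n,A^{nd})$ ($d\geq0$) are the unique ones such that $g_n^0=1$; $g_n^{d+1}(0)=0$ for all $d\geq0$; $(g_n^{d+1})^-=g_n^d$ if $d$ is even; $(g_n^{d+1})^+=g_n^d$ if $d$ is odd. There is a unique operator $\alpha\mapsto\widetilde\alpha$ on $M$ such that $\alpha(\langle\mu\rangle q)=\alpha(q)+\{\mu\}\widetilde\alpha(q)$ for all $K$, $q\in I^n(K)$, $\mu\in K^*$. $\delta(A)\in A(k)$ is the unique element such that the restriction of $f_1$ to $I^2$ equals $\delta(A)f_2$ (it is $1$ for $A=W$, $0$ for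 $A=H^*(-,\mu_2)$). $\{-1\}=f_1(\langle\langle-1\rangle\rangle)$, and $\{-1\}^0=1$. *)

(* Defs.v *)
From HB Require Import structures.
From mathcomp Require Import all_boot all_order all_algebra.
From mathcomp Require Import boolp classical_sets mxtens.

Set Implicit Arguments.
Unset Strict Implicit.
Unset Printing Implicit Defensive.

Import GRing.Theory.
Local Open Scope ring_scope.
Local Open Scope quotient_scope.

(* K^* *)
Definition nz (K : fieldType) := {a : K | a != 0}.
Definition nz1 (K : fieldType) : nz K := exist _ 1 (oner_neq0 K).
Lemma nzN_proof (K : fieldType) (a : nz K) : - sval a != 0.
Proof. by rewrite oppr_eq0 (valP a). Qed.
Definition nzN (K : fieldType) (a : nz K) : nz K := exist _ (- sval a) (nzN_proof a).
Lemma nzmap_proof (K L : fieldType) (h : {rmorphism K -> L}) (a : nz K) :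
  h (sval a) != 0.
Proof. by rewrite fmorph_eq0 (valP a). Qed.
Definition nzmap (K L : fieldType) (h : {rmorphism K -> L}) (a : nz K) : nz L :=
  exist _ (h (sval a)) (nzmap_proof h a).

Section Forms.
Variable K : fieldType.

(* In characteristic different from 2, the nondegenerate quadratic form       *)
(* x |-> x *m G *m x^T is encoded by its Gram matrix G.                       *)
Definition qform :=
  {G : {n & 'M[K]_n} |
    ((tagged G)^T == tagged G) && (tagged G \in unitmx)}.

Definition qdim (q : qform) : nat := tag (val q).
Definition gram (q : qform) : 'M[K]_(qdim q) := tagged (val q).

Definition mkQform n (G : 'M[K]_n) (hG : (G^T == G) && (G \in unitmx)) : qform :=
  exist (fun G : {n & 'M[K]_n} => ((tagged G)^T == tagged G) &&
                                  (tagged G \in unitmx))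
        (Tagged (fun n => 'M[K]_n) G) hG.

Definition isometric (q q' : qform) : Prop :=
  exists (P : 'M[K]_(qdim q, qdim q')) (P' : 'M[K]_(qdim q', qdim q)),
    [/\ P *m P' = 1%:M, P' *m P = 1%:M & P *m gram q' *m P^T = gram q].

Lemma gramT q : (gram q)^T = gram q.
Proof. by case/andP: (valP q) => /eqP. Qed.

Lemma gram_unit q : gram q \in unitmx.
Proof. by case/andP: (valP q). Qed.

Lemma isometric_refl q : isometric q q.
Proof.
by exists 1%:M, 1%:M; split; rewrite ?mulmx1 // mul1mx trmx1 mulmx1.
Qed.

Lemma isometric_sym q q' : isometric q q' -> isometric q' q.
Proof.
case=> P [P' [PP' P'P PG]]; exists P', P; split=> //; rewrite -PG.
by rewrite !mulmxA P'P mul1mx -mulmxA -trmx_mul P'P trmx1 mulmx1.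
Qed.

Lemma isometric_trans q2 q1 q3 :
  isometric q1 q2 -> isometric q2 q3 -> isometric q1 q3.
Proof.
case=> P [P' [PP' P'P PG]] [Q [Q' [QQ' Q'Q QG]]].
exists (P *m Q), (Q' *m P'); split.
- by rewrite mulmxA -(mulmxA P) QQ' mulmx1.
- by rewrite mulmxA -(mulmxA Q') P'P mulmx1.
- by rewrite -PG -QG trmx_mul !mulmxA.
Qed.

Lemma tensmx11 m n : (1%:M : 'M[K]_m) *t (1%:M : 'M[K]_n) = 1%:M.
Proof.
apply/matrixP=> i j; case: (mxtens_indexP i) => i1 i2.
case: (mxtens_indexP j) => j1 j2; rewrite tensmxE !mxE.
rewrite (can_eq (@mxtens_indexK m n)) xpair_eqE -natrM mulnb.
by [].
Qed.

Lemma perp_proof (q q' : qform) (G := block_mx (gram q) 0 0 (gram q')) :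
  (G^T == G) && (G \in unitmx).
Proof.
rewrite /G tr_block_mx !trmx0 !gramT eqxx /= unitmxE det_ublock unitrM.
by rewrite -!unitmxE !gram_unit.
Qed.
Definition perp q q' := mkQform (perp_proof q q').

Lemma tensor_proof (q q' : qform) (G := gram q *t gram q') :
  (G^T == G) && (G \in unitmx).
Proof.
rewrite /G trmx_tens !gramT eqxx /=.
suff: G *m (invmx (gram q) *t invmx (gram q')) = 1%:M by case/mulmx1_unit.
by rewrite tensmx_mul !mulmxV ?gram_unit // tensmx11.
Qed.
Definition tensor q q' := mkQform (tensor_proof q q').

Lemma form0_proof (G := 0 : 'M[K]_0) : (G^T == G) && (G \in unitmx).
Proof. by rewrite trmx0 eqxx unitmxE det_mx00 unitr1. Qed.
Definition form0 := mkQform form0_proof.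

Lemma form1_proof (a : nz K) (G := (sval a)%:M : 'M[K]_1) :
  (G^T == G) && (G \in unitmx).
Proof. by rewrite tr_scalar_mx eqxx unitmxE det_scalar1 unitfE (valP a). Qed.
(* the form <a> *)
Definition form1 a := mkQform (form1_proof a).

Lemma hyp_plane_proof (G := block_mx 0 1%:M 1%:M 0 : 'M[K]_(1 + 1)) :
  (G^T == G) && (G \in unitmx).
Proof.
rewrite /G tr_block_mx !trmx0 !trmx1 eqxx /=.
suff: G *m G = 1%:M by case/mulmx1_unit.
by rewrite mulmx_block !mul0mx !mulmx0 !mulmx1 !addr0 !add0r -scalar_mx_block.
Qed.
Definition hyp_plane := mkQform hyp_plane_proof.

(* q is, up to relabelling of the basis, the form with Gram function B *)
Let presented (q : qform) (T : Type) (B : T -> T -> K) :=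
  exists2 e : 'I_(qdim q) -> T, bijective e & forall i j, gram q i j = B (e i) (e j).

Let presented_isometric q q' T T' B B' (h : T -> T') :
  @presented q T B -> @presented q' T' B' -> bijective h ->
  (forall s t, B s t = B' (h s) (h t)) -> isometric q q'.
Proof.
case=> e [e' eK e'K] eB [d [d' dK d'K] dB] [h' hK h'K] hB.
pose f i := d' (h (e i)); pose g j := e' (h' (d j)).
have fK : cancel f g by move=> i; rewrite /f /g d'K hK eK.
have gK : cancel g f by move=> j; rewrite /f /g e'K h'K dK.
exists (\matrix_(i, j) (f i == j)%:R), (\matrix_(j, i) (f i == j)%:R).
have sum1 n (F : 'I_n -> K) j : \sum_i (i == j)%:R * F i = F j.
  rewrite (bigD1 j) //= eqxx mul1r big1 ?addr0 // => i /negPf->.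
  by rewrite mul0r.
split; apply/matrixP=> i j; rewrite !mxE.
- under eq_bigr => k _ do rewrite !mxE eq_sym.
  by rewrite sum1 (can_eq fK) eq_sym.
- under eq_bigr => k _ do rewrite !mxE (can2_eq fK gK).
  by rewrite sum1 gK.
- under eq_bigr => k _ do rewrite mulrC !mxE eq_sym.
  rewrite sum1; under eq_bigr => k _ do rewrite mxE eq_sym.
  by rewrite sum1 dB eB hB !d'K.
Qed.

Let presented_id q : presented q (gram q).
Proof. by exists id => //; exists id. Qed.

Let sumB T T' (B : T -> T -> K) (B' : T' -> T' -> K) (s t : T + T') : K :=
  match s, t with
  | inl x, inl y => B x y | inr x, inr y => B' x y | _, _ => 0
  end.

Let prodB T T' (B : T -> T -> K) (B' : T' -> T' -> K) (s t : T * T') : K :=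
  B s.1 t.1 * B' s.2 t.2.

Let presented_perp q q' T T' B B' :
  @presented q T B -> @presented q' T' B' -> presented (perp q q') (sumB B B').
Proof.
case=> e [e' eK e'K] eB [d [d' dK d'K] dB].
pose h (i : 'I_(qdim q + qdim q')) : T + T' :=
  match split i with inl x => inl (e x) | inr y => inr (d y) end.
pose h' (s : T + T') : 'I_(qdim q + qdim q') :=
  unsplit (match s with inl x => inl (e' x) | inr y => inr (d' y) end).
exists h; first exists h'.
- move=> i; rewrite /h /h' -[in RHS](splitK i).
  by case: (split i) => x; rewrite ?eK ?dK.
- by move=> s; rewrite /h /h' unsplitK; case: s => x; rewrite ?e'K ?d'K.
move=> i j; rewrite /gram /= /h /block_mx /col_mx /row_mx !mxE.
by case: (split i) => x; rewrite !mxE; case: (split j) => y;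
  rewrite ?mxE //= -?eB -?dB.
Qed.

Let presented_tensor q q' T T' B B' :
  @presented q T B -> @presented q' T' B' ->
  presented (tensor q q') (prodB B B').
Proof.
case=> e [e' eK e'K] eB [d [d' dK d'K] dB].
exists (fun i => let u := mxtens_unindex i in (e u.1, d u.2)).
  exists (fun u => mxtens_index (e' u.1, d' u.2)) => [i|[x y]].
    by case: (mxtens_indexP i) => x y; rewrite mxtens_indexK /= eK dK.
  by rewrite mxtens_indexK /= e'K d'K.
move=> i j; rewrite /gram /= mxE /prodB /= -eB -dB; congr (_ * _).
Qed.

Let presented1 a : presented (form1 a) (fun s t : unit => sval a).
Proof.
exists (fun _ => tt); last by move=> i j; rewrite /gram /= !ord1 mxE.
by exists (fun _ => ord0); [move=> i; exact/esym/ord1 | case].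
Qed.

Let no_ord0 (T : Type) : 'I_(qdim form0) -> T.
Proof. by case. Qed.

Lemma perpA q1 q2 q3 :
  isometric (perp q1 (perp q2 q3)) (perp (perp q1 q2) q3).
Proof.
pose h T1 T2 T3 (s : T1 + (T2 + T3)) : (T1 + T2) + T3 :=
  match s with
  | inl x => inl (inl x) | inr (inl y) => inl (inr y) | inr (inr z) => inr z
  end.
apply: (presented_isometric (h := @h _ _ _)
  (presented_perp (presented_id _)
     (presented_perp (presented_id _) (presented_id _)))
  (presented_perp
     (presented_perp (presented_id _) (presented_id _)) (presented_id _))).
  exists (fun s => match s with
    | inl (inl x) => inl x | inl (inr y) => inr (inl y) | inr z => inr (inr z)
    end); by [case=> [|[]] | case=> [[]|]].
by case=> [x|[x|x]] [y|[y|y]].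
Qed.

Lemma perpC q1 q2 : isometric (perp q1 q2) (perp q2 q1).
Proof.
pose h T1 T2 (s : T1 + T2) : T2 + T1 :=
  match s with inl x => inr x | inr y => inl y end.
apply: (presented_isometric (h := @h _ _)
  (presented_perp (presented_id _) (presented_id _))
  (presented_perp (presented_id _) (presented_id _))).
  by exists (@h _ _); case.
by case=> x [y|y].
Qed.

Lemma perp0 q : isometric (perp form0 q) q.
Proof.
pose h (s : 'I_(qdim form0) + 'I_(qdim q)) : 'I_(qdim q) :=
  match s with inl x => no_ord0 _ x | inr y => y end.
apply: (presented_isometric (h := h)
  (presented_perp (presented_id _) (presented_id _)) (presented_id _)).
  by exists inr => // -[[]|].
by case=> [[]|x] // [[]|y].
Qed.

Lemma tensorA q1 q2 q3 :
  isometric (tensor q1 (tensor q2 q3)) (tensor (tensor q1 q2) q3).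
Proof.
pose h T1 T2 T3 (s : T1 * (T2 * T3)) : (T1 * T2) * T3 :=
  (s.1, s.2.1, s.2.2).
apply: (presented_isometric (h := @h _ _ _)
  (presented_tensor (presented_id _)
     (presented_tensor (presented_id _) (presented_id _)))
  (presented_tensor
     (presented_tensor (presented_id _) (presented_id _)) (presented_id _))).
  by exists (fun s => (s.1.1, (s.1.2, s.2))); [case=> ? [] | case=> -[]].
by move=> [x [y z]] [x' [y' z']]; rewrite /prodB /= mulrA.
Qed.

Lemma tensorC q1 q2 : isometric (tensor q1 q2) (tensor q2 q1).
Proof.
pose h T1 T2 (s : T1 * T2) : T2 * T1 := (s.2, s.1).
apply: (presented_isometric (h := @h _ _)
  (presented_tensor (presented_id _) (presented_id _))
  (presented_tensor (presented_id _) (presented_id _))).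
  by exists (@h _ _); case.
by move=> [x y] [x' y']; rewrite /prodB /= mulrC.
Qed.

Lemma tensor_perp q1 q2 q3 :
  isometric (tensor (perp q1 q2) q3) (perp (tensor q1 q3) (tensor q2 q3)).
Proof.
pose h T1 T2 T3 (s : (T1 + T2) * T3) : T1 * T3 + T2 * T3 :=
  match s.1 with inl x => inl (x, s.2) | inr y => inr (y, s.2) end.
apply: (presented_isometric (h := @h _ _ _)
  (presented_tensor
     (presented_perp (presented_id _) (presented_id _)) (presented_id _))
  (presented_perp
     (presented_tensor (presented_id _) (presented_id _))
     (presented_tensor (presented_id _) (presented_id _)))).
  exists (fun s => match s with
    | inl x => (inl x.1, x.2) | inr y => (inr y.1, y.2) end).
    by case=> [[]].
  by case=> [[]|[]].
by move=> [[x|x] y] [[x'|x'] y']; rewrite /prodB /= ?mul0r.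
Qed.

Lemma tensor0 q : isometric (tensor form0 q) form0.
Proof.
apply: (presented_isometric (h := fst)
  (presented_tensor (presented_id _) (presented_id _)) (presented_id _)).
  by exists (@no_ord0 _); [case=> -[] | case].
by case=> -[].
Qed.

Lemma tensor1 q : isometric (tensor (form1 (nz1 K)) q) q.
Proof.
apply: (presented_isometric (h := snd)
  (presented_tensor (presented1 _) (presented_id _)) (presented_id _)).
  by exists (pair tt) => // -[[]].
by move=> [x y] [x' y']; rewrite /prodB /= mul1r.
Qed.

Lemma isometric_perp q1 q1' q2 q2' :
  isometric q1 q1' -> isometric q2 q2' ->
  isometric (perp q1 q2) (perp q1' q2').
Proof.
case=> P [P' [PP' P'P PG]] [Q [Q' [QQ' Q'Q QG]]].
exists (block_mx P 0 0 Q), (block_mx P' 0 0 Q').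
split; rewrite ?tr_block_mx !mulmx_block !(mul0mx, mulmx0, addr0, add0r, trmx0).
- by rewrite PP' QQ' -scalar_mx_block.
- by rewrite P'P Q'Q -scalar_mx_block.
- by rewrite PG QG.
Qed.

Lemma isometric_tensor q1 q1' q2 q2' :
  isometric q1 q1' -> isometric q2 q2' ->
  isometric (tensor q1 q2) (tensor q1' q2').
Proof.
case=> P [P' [PP' P'P PG]] [Q [Q' [QQ' Q'Q QG]]].
exists (P *t Q), (P' *t Q').
by split; rewrite ?trmx_tens !tensmx_mul ?PP' ?QQ' ?P'P ?Q'Q ?PG ?QG ?tensmx11.
Qed.

Lemma isometric_dim q q' : isometric q q' -> qdim q = qdim q'.
Proof.
case=> P [P' [PP' P'P _]]; apply/eqP; rewrite eqn_leq.
by rewrite (mulmx1_min PP') (mulmx1_min P'P).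
Qed.

Definition isometricb (q q' : qform) : bool := `[<isometric q q'>].

Lemma isometricb_refl : reflexive isometricb.
Proof. by move=> q; apply/asboolP/isometric_refl. Qed.

Lemma isometricb_sym : symmetric isometricb.
Proof. by move=> q q'; apply/asboolP/asboolP; apply: isometric_sym. Qed.

Lemma isometricb_trans : transitive isometricb.
Proof.
by move=> q2 q1 q3 /asboolP q12 /asboolP q23; apply/asboolP/isometric_trans/q23.
Qed.

Canonical isometricb_equiv :=
  EquivRel isometricb isometricb_refl isometricb_sym isometricb_trans.

(* The semiring of isometry classes under orthogonal sum and tensor product.  *)
Definition isoclass := {eq_quot isometricb}.
HB.instance Definition _ : EqQuotient _ isometricb isoclass :=
  EqQuotient.on isoclass.
HB.instance Definition _ := Choice.on isoclass.

Lemma eq_isoclass q q' :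
  isometric q q' <-> \pi_isoclass q = \pi_isoclass q'.
Proof.
by split=> [h | /eqmodP/asboolP//]; apply/eqmodP/asboolP.
Qed.

Lemma repr_isometric q : isometric (repr (\pi_isoclass q)) q.
Proof. by apply/eq_isoclass; rewrite reprK. Qed.

Definition iso_zero : isoclass := lift_cst isoclass form0.
Definition iso_one : isoclass := lift_cst isoclass (form1 (nz1 K)).
Definition iso_add := lift_op2 isoclass perp.
Definition iso_mul := lift_op2 isoclass tensor.

Canonical pi_iso_zero := PiConst iso_zero.
Canonical pi_iso_one := PiConst iso_one.

Lemma pi_perp : {morph \pi : x y / perp x y >-> iso_add x y}.
Proof.
move=> x y; unlock iso_add; apply/eq_isoclass.
by apply: isometric_perp; apply/isometric_sym/repr_isometric.
Qed.
Canonical pi_iso_add := PiMorph2 pi_perp.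

Lemma pi_tensor : {morph \pi : x y / tensor x y >-> iso_mul x y}.
Proof.
move=> x y; unlock iso_mul; apply/eq_isoclass.
by apply: isometric_tensor; apply/isometric_sym/repr_isometric.
Qed.
Canonical pi_iso_mul := PiMorph2 pi_tensor.

Lemma iso_addA : associative iso_add.
Proof.
elim/quotW=> x; elim/quotW=> y; elim/quotW=> z; rewrite !piE.
exact/eq_isoclass/perpA.
Qed.

Lemma iso_addC : commutative iso_add.
Proof.
by elim/quotW=> x; elim/quotW=> y; rewrite !piE; apply/eq_isoclass/perpC.
Qed.

Lemma iso_add0 : left_id iso_zero iso_add.
Proof. by elim/quotW=> x; rewrite !piE; apply/eq_isoclass/perp0. Qed.

Lemma iso_mulA : associative iso_mul.
Proof.
elim/quotW=> x; elim/quotW=> y; elim/quotW=> z; rewrite !piE.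
exact/eq_isoclass/tensorA.
Qed.

Lemma iso_mulC : commutative iso_mul.
Proof.
by elim/quotW=> x; elim/quotW=> y; rewrite !piE; apply/eq_isoclass/tensorC.
Qed.

Lemma iso_mul1 : left_id iso_one iso_mul.
Proof. by elim/quotW=> x; rewrite !piE; apply/eq_isoclass/tensor1. Qed.

Lemma iso_mulD : left_distributive iso_mul iso_add.
Proof.
elim/quotW=> x; elim/quotW=> y; elim/quotW=> z; rewrite !piE.
exact/eq_isoclass/tensor_perp.
Qed.

Lemma iso_mul0 : left_zero iso_zero iso_mul.
Proof. by elim/quotW=> x; rewrite !piE; apply/eq_isoclass/tensor0. Qed.

HB.instance Definition _ :=
  GRing.isNmodule.Build isoclass iso_addA iso_addC iso_add0.
HB.instance Definition _ :=
  GRing.Nmodule_isComPzSemiRing.Build isoclass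
    iso_mulA iso_mulC iso_mul1 iso_mulD iso_mul0.

Lemma pi_form0 : \pi_isoclass form0 = 0.
Proof. by rewrite -[0]/iso_zero piE. Qed.

Lemma pi_form1 : \pi_isoclass (form1 (nz1 K)) = 1.
Proof. by rewrite -[1 in RHS]/iso_one piE. Qed.

Lemma pi_isoD q q' :
  \pi_isoclass (perp q q') = \pi_isoclass q + \pi_isoclass q'.
Proof. exact: pi_perp. Qed.

Lemma pi_isoM q q' :
  \pi_isoclass (tensor q q') = \pi_isoclass q * \pi_isoclass q'.
Proof. exact: pi_tensor. Qed.

Definition iso_dim (x : isoclass) : nat := qdim (repr x).

Lemma iso_dim_pi q : iso_dim (\pi_isoclass q) = qdim q.
Proof. exact/isometric_dim/repr_isometric. Qed.

Lemma iso_dim_nmod : nmod_morphism iso_dim.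
Proof.
split; first by rewrite -pi_form0 iso_dim_pi.
by elim/quotW=> x; elim/quotW=> y; rewrite -pi_isoD !iso_dim_pi.
Qed.

Lemma iso_dim_monoid : monoid_morphism iso_dim.
Proof.
split; first by rewrite -pi_form1 iso_dim_pi.
by elim/quotW=> x; elim/quotW=> y; rewrite -pi_isoM !iso_dim_pi.
Qed.

HB.instance Definition _ :=
  GRing.isNmodMorphism.Build isoclass nat iso_dim iso_dim_nmod.
HB.instance Definition _ :=
  GRing.isMonoidMorphism.Build isoclass nat iso_dim iso_dim_monoid.

End Forms.

Section FormExtension.
Variables (K L : fieldType) (h : {rmorphism K -> L}).

Lemma map_form_proof (q : qform K) (G := map_mx h (gram q)) :
  (G^T == G) && (G \in unitmx).
Proof. by rewrite /G map_trmx gramT eqxx map_unitmx gram_unit. Qed.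
Definition map_form q := mkQform (map_form_proof q).

Let eq_form n (G G' : 'M[L]_n) hG hG' :
  G = G' -> @mkQform L n G hG = @mkQform L n G' hG'.
Proof. by move=> eG; apply: val_inj; rewrite /= eG. Qed.

Lemma map_perp q q' : map_form (perp q q') = perp (map_form q) (map_form q').
Proof. by apply: eq_form; rewrite /gram /= map_block_mx !map_mx0. Qed.

Lemma map_tensor q q' :
  map_form (tensor q q') = tensor (map_form q) (map_form q').
Proof. by apply: eq_form; rewrite /gram /= map_mxT. Qed.

Lemma map_form0 : map_form (form0 K) = form0 L.
Proof. by apply: eq_form; rewrite /gram /= map_mx0. Qed.

Lemma map_form1 (a : nz K) : map_form (form1 a) = form1 (nzmap h a).
Proof. by apply: eq_form; rewrite /gram /= map_scalar_mx. Qed.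

Lemma map_hyp_plane : map_form (hyp_plane K) = hyp_plane L.
Proof. by apply: eq_form; rewrite /gram /= map_block_mx !map_mx0 !map_mx1. Qed.

Lemma map_isometric q q' :
  isometric q q' -> isometric (map_form q) (map_form q').
Proof.
case=> P [P' [PP' P'P PG]]; exists (map_mx h P), (map_mx h P').
by rewrite /gram /= map_trmx -!map_mxM PP' P'P PG !map_mx1.
Qed.

Definition iso_map (x : isoclass K) : isoclass L :=
  \pi_(isoclass L) (map_form (repr x)).

Lemma iso_map_pi q : iso_map (\pi_(isoclass K) q) = \pi_(isoclass L) (map_form q).
Proof. exact/eq_isoclass/map_isometric/repr_isometric. Qed.

Lemma iso_map_nmod : nmod_morphism iso_map.
Proof.
split; first by rewrite -!pi_form0 iso_map_pi map_form0.
by elim/quotW=> x; elim/quotW=> y; rewrite -pi_isoD !iso_map_pi map_perp pi_isoD.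
Qed.

Lemma iso_map_monoid : monoid_morphism iso_map.
Proof.
split.
  rewrite -!pi_form1 iso_map_pi map_form1; congr (\pi_(isoclass L) (form1 _)).
  by apply: val_inj; rewrite /= rmorph1.
elim/quotW=> x; elim/quotW=> y.
by rewrite -pi_isoM !iso_map_pi map_tensor pi_isoM.
Qed.

HB.instance Definition _ :=
  GRing.isNmodMorphism.Build (isoclass K) (isoclass L) iso_map iso_map_nmod.
HB.instance Definition _ :=
  GRing.isMonoidMorphism.Build (isoclass K) (isoclass L) iso_map iso_map_monoid.

End FormExtension.

Section Grothendieck.
Variable S : comPzSemiRingType.
Implicit Types x y z : S * S.

Definition groth_eq x y : bool :=
  `[< exists e, x.1 + y.2 + e = y.1 + x.2 + e >].

Lemma groth_eq_refl : reflexive groth_eq.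
Proof. by move=> x; apply/asboolP; exists 0. Qed.

Lemma groth_eq_sym : symmetric groth_eq.
Proof. by move=> x y; apply/asboolP/asboolP=> -[e he]; exists e. Qed.

Lemma groth_eq_trans : transitive groth_eq.
Proof.
move=> [b b'] [a a'] [c c'] /asboolP[e /= he] /asboolP[e' /= he'].
apply/asboolP; exists (b + b' + e + e') => /=.
rewrite !addrA (ACl ((1*4*5)*(3*2*6)))/= he he'.
by rewrite (AC (3*3) (4*2*1*5*3*6))/=.
Qed.

Canonical groth_equiv :=
  EquivRel groth_eq groth_eq_refl groth_eq_sym groth_eq_trans.

(* The Grothendieck ring of the commutative semiring S: the class of (a, b)   *)
(* stands for the formal difference a - b.                                    *)
Definition groth := {eq_quot groth_eq}.
HB.instance Definition _ : EqQuotient _ groth_eq groth := EqQuotient.on groth.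
HB.instance Definition _ := Choice.on groth.

Lemma eq_groth x y :
  (exists e, x.1 + y.2 + e = y.1 + x.2 + e) <-> \pi_groth x = \pi_groth y.
Proof. by split=> [h | /eqmodP/asboolP//]; apply/eqmodP/asboolP. Qed.

Definition gzero : groth := lift_cst groth (0, 0).
Definition gone : groth := lift_cst groth (1, 0).
Definition gopp := lift_op1 groth (fun x => (x.2, x.1)).
Definition gadd := lift_op2 groth (fun x y => (x.1 + y.1, x.2 + y.2)).
Definition gmul := lift_op2 groth
  (fun x y => (x.1 * y.1 + x.2 * y.2, x.1 * y.2 + x.2 * y.1)).

Canonical pi_gzero := PiConst gzero.
Canonical pi_gone := PiConst gone.

Lemma pi_gopp : {morph \pi : x / (x.2, x.1) >-> gopp x}.
Proof.
move=> x; unlock gopp; apply/eq_groth.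
have /eq_groth[e /= he] := esym (reprK (\pi_groth x)).
by exists e; rewrite /= [x.2 + _]addrC -he [_ + x.1]addrC.
Qed.
Canonical pi_gopp_morph := PiMorph1 pi_gopp.

Lemma pi_gadd : {morph \pi : x y / (x.1 + y.1, x.2 + y.2) >-> gadd x y}.
Proof.
move=> x y; unlock gadd; apply/eq_groth.
have /eq_groth[e /= he] := esym (reprK (\pi_groth x)).
have /eq_groth[e' /= he'] := esym (reprK (\pi_groth y)).
exists (e + e') => /=.
rewrite (AC (2*2*2) ((1*3*5)*(2*4*6)))/= he he'.
by rewrite (AC (3*3) ((1*4)*(2*5)*(3*6)))/=.
Qed.
Canonical pi_gadd_morph := PiMorph2 pi_gadd.

Let gmulf x y : S * S := (x.1 * y.1 + x.2 * y.2, x.1 * y.2 + x.2 * y.1).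

Let gmulfC x y : gmulf x y = gmulf y x.
Proof.
rewrite /gmulf; congr (_, _); first by rewrite mulrC [x.2 * _]mulrC.
by rewrite mulrC [x.2 * _]mulrC addrC.
Qed.

Let gmulf_l x x' y :
  \pi_groth x = \pi_groth x' -> \pi_groth (gmulf x y) = \pi_groth (gmulf x' y).
Proof.
move=> /eq_groth[e he]; apply/eq_groth; exists (e * y.1 + e * y.2) => /=.
rewrite (AC (2*2*2) ((1*4*5)*(3*2*6)))/= [RHS](AC (2*2*2) ((1*4*5)*(3*2*6)))/=.
by rewrite -!mulrDl he.
Qed.

Lemma pi_gmul : {morph \pi : x y /
  (x.1 * y.1 + x.2 * y.2, x.1 * y.2 + x.2 * y.1) >-> gmul x y}.
Proof.
move=> x y; unlock gmul; rewrite -/(gmulf _ _) -/(gmulf _ _).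
rewrite (@gmulf_l x (repr (\pi_groth x))) ?reprK // gmulfC.
by rewrite (@gmulf_l y (repr (\pi_groth y))) ?reprK // gmulfC.
Qed.
Canonical pi_gmul_morph := PiMorph2 pi_gmul.

Lemma gaddA : associative gadd.
Proof.
by elim/quotW=> x; elim/quotW=> y; elim/quotW=> z; rewrite !piE /= !addrA.
Qed.

Lemma gaddC : commutative gadd.
Proof.
by elim/quotW=> x; elim/quotW=> y; rewrite !piE addrC [x.2 + _]addrC.
Qed.

Lemma gadd0 : left_id gzero gadd.
Proof. by elim/quotW=> -[a b]; rewrite !piE /= !add0r. Qed.

Lemma gaddN : left_inverse gzero gopp gadd.
Proof.
elim/quotW=> -[a b]; rewrite !piE; apply/eq_groth; exists 0 => /=.
by rewrite !addr0 !add0r addrC.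
Qed.

HB.instance Definition _ := GRing.isZmodule.Build groth gaddA gaddC gadd0 gaddN.

Lemma gmulA : associative gmul.
Proof.
elim/quotW=> x; elim/quotW=> y; elim/quotW=> z; rewrite !piE /=.
congr (\pi_groth (_, _)); rewrite !mulrDl !mulrDr !mulrA.
  by rewrite (AC (2*2) ((1*4)*(2*3)))/=.
by rewrite (AC (2*2) ((1*4)*(2*3)))/=.
Qed.

Lemma gmulC : commutative gmul.
Proof. by elim/quotW=> x; elim/quotW=> y; rewrite !piE -/(gmulf _ _) gmulfC. Qed.

Lemma gmul1 : left_id gone gmul.
Proof. by elim/quotW=> -[a b]; rewrite !piE /= !mul1r !mul0r !addr0. Qed.

Lemma gmulD : left_distributive gmul gadd.
Proof.
elim/quotW=> x; elim/quotW=> y; elim/quotW=> z; rewrite !piE /=.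
by congr (\pi_groth (_, _)); rewrite !mulrDl addrACA.
Qed.

HB.instance Definition _ :=
  GRing.Zmodule_isComPzRing.Build groth gmulA gmulC gmul1 gmulD.

Definition groth_of (a : S) : groth := \pi_groth (a, 0).

Lemma pi_groth_sub x : \pi_groth x = groth_of x.1 - groth_of x.2.
Proof.
rewrite /groth_of -[- _]/(gopp _) -[_ + _]/(gadd _ _) !piE /=.
by rewrite addr0 add0r -surjective_pairing.
Qed.

Lemma groth_of_nmod : nmod_morphism groth_of.
Proof.
split=> [|a b]; first by rewrite /groth_of -[0 in RHS]/gzero piE.
by rewrite /groth_of -[_ + _ in RHS]/(gadd _ _) !piE /= addr0.
Qed.

Lemma groth_of_monoid : monoid_morphism groth_of.
Proof.
split=> [|a b]; first by rewrite /groth_of -[1 in RHS]/gone piE.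
rewrite /groth_of -[_ * _ in RHS]/(gmul _ _) !piE /=.
by rewrite !(mulr0, mul0r, addr0).
Qed.

HB.instance Definition _ := GRing.isNmodMorphism.Build S groth groth_of groth_of_nmod.
HB.instance Definition _ :=
  GRing.isMonoidMorphism.Build S groth groth_of groth_of_monoid.

Section Lift.
Variables (R : comPzRingType) (h : {rmorphism S -> R}).

Definition groth_lift (x : groth) : R := locked (h (repr x).1 - h (repr x).2).

Lemma groth_lift_pi x : groth_lift (\pi_groth x) = h x.1 - h x.2.
Proof.
rewrite /groth_lift -lock; have /eq_groth[e /(congr1 h)] := reprK (\pi_groth x).
rewrite !rmorphD => /addIr he; apply/eqP.
by rewrite subr_eq addrAC eq_sym subr_eq eq_sym he.
Qed.

Lemma groth_liftE a : groth_lift (groth_of a) = h a.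
Proof. by rewrite groth_lift_pi rmorph0 subr0. Qed.

Lemma groth_lift_zmod : zmod_morphism groth_lift.
Proof.
elim/quotW=> x; elim/quotW=> y; rewrite !groth_lift_pi.
rewrite -[- _]/(gopp _) -[X in groth_lift X]/(gadd _ _) !piE groth_lift_pi /=.
by rewrite !rmorphD opprB opprD addrACA.
Qed.

Lemma groth_lift_monoid : monoid_morphism groth_lift.
Proof.
split; first by rewrite -(rmorph1 groth_of) groth_liftE rmorph1.
elim/quotW=> x; elim/quotW=> y; rewrite !groth_lift_pi.
rewrite -[X in groth_lift X]/(gmul _ _) !piE groth_lift_pi /=.
by rewrite !rmorphD !rmorphM mulrBl !mulrBr opprB opprD addrACA.
Qed.

HB.instance Definition _ :=
  GRing.isZmodMorphism.Build groth R groth_lift groth_lift_zmod.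
HB.instance Definition _ :=
  GRing.isMonoidMorphism.Build groth R groth_lift groth_lift_monoid.
End Lift.

End Grothendieck.

Section WittRing.
Variable K : fieldType.

Definition iso_dimz (x : isoclass K) : int := (iso_dim x)%:Z.

Lemma iso_dimz_nmod : nmod_morphism iso_dimz.
Proof. by split=> [|x y]; rewrite /iso_dimz ?raddf0 ?raddfD. Qed.

Lemma iso_dimz_monoid : monoid_morphism iso_dimz.
Proof. by split=> [|x y]; rewrite /iso_dimz ?rmorph1 ?rmorphM. Qed.

HB.instance Definition _ :=
  GRing.isNmodMorphism.Build (isoclass K) int iso_dimz iso_dimz_nmod.
HB.instance Definition _ :=
  GRing.isMonoidMorphism.Build (isoclass K) int iso_dimz iso_dimz_monoid.

Definition GW := groth (isoclass K).
HB.instance Definition _ := GRing.ComPzRing.on GW.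

Definition GWform (q : qform K) : GW := groth_of (\pi_(isoclass K) q).

(* virtual dimension *)
Definition vdim : GW -> int := groth_lift iso_dimz.
HB.instance Definition _ := GRing.RMorphism.copy vdim (groth_lift iso_dimz).

Lemma vdimE q : vdim (GWform q) = (qdim q)%:Z.
Proof. by rewrite /vdim groth_liftE /= /iso_dimz iso_dim_pi. Qed.

Lemma GW_sub (x : GW) : exists q q', x = GWform q - GWform q'.
Proof.
elim/quotW: x => -[x y]; rewrite pi_groth_sub /=.
by elim/quotW: x => q; elim/quotW: y => q'; exists q, q'.
Qed.

Lemma GW_neq0 : (1 : GW) != 0.
Proof. by apply/eqP => /(congr1 vdim); rewrite rmorph1 rmorph0. Qed.

HB.instance Definition _ := GRing.PzSemiRing_isNonZero.Build GW GW_neq0.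

(* the ideal of GW generated by the hyperbolic plane *)
Definition hyp_ideal : {pred GW} :=
  fun x => `[< exists z, x = z * GWform (hyp_plane K) >].

Lemma hyp_idealr_closed : idealr_closed hyp_ideal.
Proof.
split.
- by apply/asboolP; exists 0; rewrite mul0r.
- apply/asboolP=> -[z /(congr1 vdim)].
  rewrite rmorph1 rmorphM /= vdimE => /(congr1 (fun z => odd `|z|%N)).
  by rewrite abszM oddM andbF.
- move=> a u v /asboolP[x ->] /asboolP[y ->]; apply/asboolP.
  by exists (a * x + y); rewrite mulrDl mulrA.
Qed.
HB.instance Definition _ := isIdealr.Build GW hyp_ideal hyp_idealr_closed.

Definition W := {ideal_quot hyp_ideal}.
HB.instance Definition _ := GRing.ComNzRing.on W.

Definition Wof : GW -> W := \pi_W.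
HB.instance Definition _ := GRing.RMorphism.copy Wof \pi_W.

Lemma Wof_surj (w : W) : exists x, w = Wof x.
Proof. by exists (repr w); rewrite /Wof reprK. Qed.

Lemma Wof_eq0 x : Wof x = 0 <-> exists z, x = z * GWform (hyp_plane K).
Proof.
rewrite -(rmorph0 Wof); split=> [/eqP | [z ->]].
  by rewrite -Quotient.idealrBE subr0 => /asboolP.
by apply/eqP; rewrite -Quotient.idealrBE subr0; apply/asboolP; exists z.
Qed.

(* the class of <a> in the Witt ring *)
Definition Wdiag (a : nz K) : W := Wof (GWform (form1 a)).

Lemma Wdiag_nz1 : Wdiag (nz1 K) = 1.
Proof. by rewrite /Wdiag /GWform pi_form1 !rmorph1. Qed.

(* the fundamental ideal: Witt classes of even dimension *)
Definition fund_ideal : set W :=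
  [set w | exists2 x, (2 %| vdim x)%Z & w = Wof x].

Lemma fund_idealM a w : fund_ideal w -> fund_ideal (a * w).
Proof.
case=> x hx ->; have [y ->] := Wof_surj a.
by exists (y * x); rewrite ?rmorphM //= dvdz_mull.
Qed.

(* <<a>> = <1> - <a>; the projection of GW onto W identifies the elements of  *)
(* virtual dimension 0 with fund_ideal, so this is also <<a>> in GW.          *)
Definition Wpfister1 (a : nz K) : W := Wdiag (nz1 K) - Wdiag a.

Lemma fund_ideal_pfister1 a : fund_ideal (Wpfister1 a).
Proof.
exists (GWform (form1 (nz1 K)) - GWform (form1 a)); last by rewrite rmorphB.
by rewrite rmorphB /= !vdimE.
Qed.

End WittRing.

Section WittExtension.
Variables (K L : fieldType) (h : {rmorphism K -> L}).

Definition GWmap : GW K -> GW L :=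
  groth_lift (@groth_of (isoclass L) \o iso_map h).
HB.instance Definition _ := GRing.RMorphism.copy GWmap
  (groth_lift (@groth_of (isoclass L) \o iso_map h)).

Lemma GWmap_form q : GWmap (GWform q) = GWform (map_form h q).
Proof. by rewrite /GWmap groth_liftE /= iso_map_pi. Qed.

Lemma vdim_GWmap x : vdim (GWmap x) = vdim x.
Proof.
have [q [q' ->]] := GW_sub x.
by rewrite rmorphB /= !GWmap_form !rmorphB /= !vdimE.
Qed.

Definition Wmap (w : W K) : W L := Wof (GWmap (repr w)).

Lemma Wmap_of x : Wmap (Wof x) = Wof (GWmap x).
Proof.
apply/eqP; rewrite -subr_eq0 -!rmorphB; apply/eqP.
have /Wof_eq0[z hz] : Wof (repr (Wof x) - x) = 0.
  by rewrite rmorphB /= {1}/Wof reprK subrr.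
apply/Wof_eq0; exists (GWmap z).
by rewrite hz rmorphM /= GWmap_form map_hyp_plane.
Qed.

Lemma Wmap_zmod : zmod_morphism Wmap.
Proof.
move=> v w; have [x ->] := Wof_surj v; have [y ->] := Wof_surj w.
by rewrite -rmorphB !Wmap_of !rmorphB.
Qed.

Lemma Wmap_monoid : monoid_morphism Wmap.
Proof.
split; first by rewrite -(rmorph1 (@Wof K)) Wmap_of !rmorph1.
move=> v w; have [x ->] := Wof_surj v; have [y ->] := Wof_surj w.
by rewrite -rmorphM !Wmap_of !rmorphM.
Qed.

HB.instance Definition _ := GRing.isZmodMorphism.Build (W K) (W L) Wmap Wmap_zmod.
HB.instance Definition _ := GRing.isMonoidMorphism.Build (W K) (W L) Wmap Wmap_monoid.

Lemma Wmap_diag a : Wmap (Wdiag a) = Wdiag (nzmap h a).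
Proof. by rewrite Wmap_of GWmap_form map_form1. Qed.

Lemma Wmap_pfister1 a : Wmap (Wpfister1 a) = Wpfister1 (nzmap h a).
Proof.
rewrite rmorphB /= !Wmap_diag /Wpfister1; congr (Wdiag _ - _).
by apply: val_inj; rewrite /= rmorph1.
Qed.

Lemma Wmap_fund w : fund_ideal w -> fund_ideal (Wmap w).
Proof.
case=> x hx ->; rewrite Wmap_of; exists (GWmap x) => //.
by rewrite vdim_GWmap.
Qed.

End WittExtension.

Section IdealPower.
Variables (R : comPzRingType) (J : set R).

(* J^n, with J^0 = R *)
Fixpoint ideal_pow (n : nat) : set R :=
  if n is m.+1 then
    [set x | exists2 s : seq (R * R),
      (forall p, p \in s -> J p.1 /\ ideal_pow m p.2) &
      x = \sum_(p <- s) p.1 * p.2]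
  else setT.

Hypothesis JM : forall a x, J x -> J (a * x).

Lemma ideal_pow0 n : ideal_pow n 0.
Proof. by case: n => // n; exists [::]; rewrite ?big_nil. Qed.

Lemma ideal_powD n x y : ideal_pow n x -> ideal_pow n y -> ideal_pow n (x + y).
Proof.
case: n => // n [s hs ->] [t ht ->]; exists (s ++ t); last by rewrite big_cat.
by move=> p; rewrite mem_cat => /orP[/hs | /ht].
Qed.

Lemma ideal_powZ n a x : ideal_pow n x -> ideal_pow n (a * x).
Proof.
case: n => // n [s hs ->]; exists [seq (a * p.1, p.2) | p <- s].
  by move=> _ /mapP[p /hs[hp1 hp2] ->]; split; first exact: JM.
by rewrite big_map mulr_sumr; apply: eq_bigr => p _; rewrite mulrA.
Qed.

Lemma ideal_pow_mul n x y : J x -> ideal_pow n y -> ideal_pow n.+1 (x * y).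
Proof.
move=> Jx Jy; exists [:: (x, y)]; last by rewrite big_seq1.
by move=> p; rewrite inE => /eqP->.
Qed.

Lemma ideal_powS n x : ideal_pow n.+1 x -> ideal_pow n x.
Proof.
elim: n x => // n IHn x [s hs ->]; exists s => // p /hs[hp1 hp2].
by split=> //; apply: IHn.
Qed.

End IdealPower.

Section FundamentalPowers.
Variables (n : nat) (K : fieldType).

Definition Ipow_pred : {pred W K} :=
  fun w => `[< ideal_pow (@fund_ideal K) n w >].

Lemma Ipow_zmod_closed : zmod_closed Ipow_pred.
Proof.
split=> [|x y /asboolP hx /asboolP hy]; apply/asboolP; first exact: ideal_pow0.
apply: ideal_powD => //; rewrite -mulN1r; apply: ideal_powZ => // a w.
exact: fund_idealM.
Qed.
HB.instance Definition _ := GRing.isZmodClosed.Build (W K) Ipow_pred Ipow_zmod_closed.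

(* I^n(K) *)
Definition Ipow := {w : W K | w \in Ipow_pred}.
HB.instance Definition _ := SubChoice.on Ipow.
HB.instance Definition _ := [SubChoice_isSubZmodule of Ipow by <:].

Lemma Ipow_scale_proof (a : W K) (q : Ipow) : a * val q \in Ipow_pred.
Proof.
apply/asboolP/ideal_powZ; last exact/asboolP/(valP q).
by move=> b w; apply: fund_idealM.
Qed.
Definition Ipow_scale a q : Ipow := exist _ (a * val q) (Ipow_scale_proof a q).

Lemma Ipow_scaleA a b q : Ipow_scale a (Ipow_scale b q) = Ipow_scale (a * b) q.
Proof. by apply: val_inj; rewrite /= mulrA. Qed.
Lemma Ipow_scale1 : left_id 1 Ipow_scale.
Proof. by move=> q; apply: val_inj; rewrite /= mul1r. Qed.
Lemma Ipow_scaleDr : right_distributive Ipow_scale +%R.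
Proof. by move=> a q q'; apply: val_inj; rewrite /= mulrDr. Qed.
Lemma Ipow_scaleDl q : {morph Ipow_scale^~ q : a b / a + b}.
Proof. by move=> a b; apply: val_inj; rewrite /= mulrDl. Qed.
HB.instance Definition _ := GRing.Zmodule_isLmodule.Build (W K) Ipow
  Ipow_scaleA Ipow_scale1 Ipow_scaleDr Ipow_scaleDl.

Lemma pfister_proof (t : n.-tuple (nz K)) :
  \prod_(a <- t) Wpfister1 a \in Ipow_pred.
Proof.
apply/asboolP; case: t => t /= /eqP <-; elim: t => // a t IHt.
by rewrite big_cons; apply: ideal_pow_mul => //; apply: fund_ideal_pfister1.
Qed.

(* <<a_1, ..., a_n>> *)
Definition pfister (t : n.-tuple (nz K)) : Ipow :=
  exist _ (\prod_(a <- t) Wpfister1 a) (pfister_proof t).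

Definition Pf := {q : Ipow | exists t, q = pfister t}.

End FundamentalPowers.

Lemma Isub_proof n (K : fieldType) (q : Ipow n.+1 K) : val q \in @Ipow_pred n K.
Proof. exact/asboolP/ideal_powS/asboolP/(valP q). Qed.
(* the inclusion of I^{n+1} in I^n *)
Definition Isub n (K : fieldType) (q : Ipow n.+1 K) : Ipow n K :=
  exist _ (val q) (Isub_proof q).

Section FundamentalExtension.
Variables (n : nat) (K L : fieldType) (h : {rmorphism K -> L}).

Lemma Ires_proof (q : Ipow n K) : Wmap h (val q) \in @Ipow_pred n L.
Proof.
apply/asboolP; move: (val q) (asboolW (valP q)); elim: n => // m IHm x [s hs ->].
exists [seq (Wmap h p.1, Wmap h p.2) | p <- s].
  by move=> _ /mapP[p /hs[hp1 hp2] ->]; split; [exact: Wmap_fund | exact: IHm].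
by rewrite big_map rmorph_sum; apply: eq_bigr => p _; rewrite rmorphM.
Qed.
Definition Ires (q : Ipow n K) : Ipow n L := exist _ (Wmap h (val q)) (Ires_proof q).

Lemma Ires_zmod : zmod_morphism Ires.
Proof. by move=> q q'; apply: val_inj; rewrite /= rmorphB. Qed.
HB.instance Definition _ := GRing.isZmodMorphism.Build (Ipow n K) (Ipow n L) Ires Ires_zmod.

Lemma IresZ a q : Ires (a *: q) = Wmap h a *: Ires q.
Proof. by apply: val_inj; rewrite /= rmorphM. Qed.

Lemma Ires_pfister t : Ires (pfister t) = pfister (map_tuple (nzmap h) t).
Proof.
apply: val_inj; rewrite /= rmorph_prod big_map; apply: eq_bigr => a _.
exact: Wmap_pfister1.
Qed.

Lemma Pfres_proof (p : Pf n K) : exists t, Ires (sval p) = pfister t.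
Proof.
by case: p => q [t /= ->]; exists (map_tuple (nzmap h) t); rewrite Ires_pfister.
Qed.
Definition Pfres (p : Pf n K) : Pf n L := exist _ (Ires (sval p)) (Pfres_proof p).

End FundamentalExtension.

Lemma Wmap_eq (K L : fieldType) (h h' : {rmorphism K -> L}) :
  h =1 h' -> Wmap h =1 Wmap h'.
Proof.
move=> hh' w; have [x ->] := Wof_surj w; have [q [q' ->]] := GW_sub x.
rewrite !Wmap_of !rmorphB /= !GWmap_form.
have eq_h p : map_form h p = map_form h' p.
  by apply: val_inj; rewrite /=; congr Tagged; apply: eq_map_mx.
by rewrite !eq_h.
Qed.

Lemma Wmap_id (K : fieldType) (w : W K) : Wmap idfun w = w.
Proof.
have [x ->] := Wof_surj w; have [q [q' ->]] := GW_sub x.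
rewrite !Wmap_of !rmorphB /= !GWmap_form.
have eq_id p : map_form (idfun : {rmorphism K -> K}) p = p.
  by apply: val_inj; case: p => -[m G] hG /=; rewrite map_mx_id.
by rewrite !eq_id.
Qed.

Lemma Wmap_comp (K L M : fieldType) (g : {rmorphism L -> M})
  (h : {rmorphism K -> L}) (w : W K) : Wmap (g \o h) w = Wmap g (Wmap h w).
Proof.
have [x ->] := Wof_surj w; have [q [q' ->]] := GW_sub x.
rewrite !Wmap_of !rmorphB /= !GWmap_form.
have eq_comp p : map_form (g \o h) p = map_form g (map_form h p).
  by apply: val_inj; rewrite /= /gram /= map_mx_comp.
by rewrite !eq_comp.
Qed.

Lemma Ires_id n (K : fieldType) (q : Ipow n K) : Ires idfun q = q.
Proof. by apply: val_inj; rewrite /= Wmap_id. Qed.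

Lemma Ires_comp n (K L M : fieldType) (g : {rmorphism L -> M})
  (h : {rmorphism K -> L}) (q : Ipow n K) : Ires (g \o h) q = Ires g (Ires h q).
Proof. by apply: val_inj; rewrite /= Wmap_comp. Qed.

Section Extensions.
Variable k : fieldType.

Record fext := FExt {
  fext_field :> fieldType;
  fext_emb : {rmorphism k -> fext_field} }.

Record fhom (K L : fext) := FHom {
  fhom_map :> {rmorphism K -> L};
  fhom_emb : forall x, fhom_map (fext_emb K x) = fext_emb L x }.

Definition fid (K : fext) : fhom K K :=
  @FHom K K idfun (fun x => erefl (fext_emb K x)).

Lemma fcomp_proof (K L M : fext) (g : fhom L M) (h : fhom K L) x :
  (g \o h) (fext_emb K x) = fext_emb M x.
Proof. by rewrite /= !fhom_emb. Qed.
Definition fcomp (K L M : fext) (g : fhom L M) (h : fhom K L) : fhom K M :=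
  @FHom K M (g \o h) (fcomp_proof g h).

(* k as an extension of itself *)
Definition fbase : fext := @FExt k idfun.
Definition fbase_hom (K : fext) : fhom fbase K :=
  @FHom fbase K (fext_emb K) (fun x => erefl (fext_emb K x)).

Lemma fhom_ext (K L : fext) (g h : fhom K L) : g =1 h -> g = h.
Proof.
case: g h => [g hg] [h hh] /= /funext gh.
have eq_gh : g = h.
  case: g h gh {hg hh} => [g [[g1] [g2]]] [h [[h1] [h2]]] /= gh.
  subst h.
  by rewrite (Prop_irrelevance g1 h1) (Prop_irrelevance g2 h2).
by subst h; congr FHom; apply: Prop_irrelevance.
Qed.

(* Functors from the extensions of k to filtered commutative rings, where     *)
(* ff_filt d stands for A^d and the intersection of the A^d is 0.             *)
Record filtered_functor := FilteredFunctor {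
  ff_ring :> fext -> comPzRingType;
  ff_res : forall K L : fext, fhom K L -> {rmorphism ff_ring K -> ff_ring L};
  ff_res_id : forall (K : fext) (x : ff_ring K), ff_res (fid K) x = x;
  ff_res_comp :
    forall (K L M : fext) (g : fhom L M) (h : fhom K L) (x : ff_ring K),
      ff_res (fcomp g h) x = ff_res g (ff_res h x);
  ff_filt : forall K : fext, nat -> set (ff_ring K);
  ff_filt0 : forall (K : fext) (x : ff_ring K), ff_filt 0 x;
  ff_filtS : forall (K : fext) d (x : ff_ring K), ff_filt d.+1 x -> ff_filt d x;
  ff_filt_0 : forall (K : fext) d, ff_filt d (0 : ff_ring K);
  ff_filtB : forall (K : fext) d (x y : ff_ring K),
    ff_filt d x -> ff_filt d y -> ff_filt d (x - y);
  ff_filtM : forall (K : fext) d e (x y : ff_ring K),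
    ff_filt d x -> ff_filt e y -> ff_filt (d + e) (x * y);
  ff_filt_res : forall (K L : fext) (h : fhom K L) d (x : ff_ring K),
    ff_filt d x -> ff_filt d (ff_res h x);
  ff_filt_sep : forall (K : fext) (x : ff_ring K),
    (forall d, ff_filt d x) -> x = 0 }.

Arguments ff_res {A K L} h : rename.
Arguments ff_filt {A K} d : rename.

(* {a} = f_1(<<a>>) *)
Definition symb_of (A : filtered_functor)
    (f : forall (n : nat) (K : fext), Ipow n K -> A K) (K : fext) (a : nz K) : A K :=
  f 1%N K (pfister [tuple a]).

(* Such a functor A together with maps f_n : I^n -> A^n. Only f_1 is assumed  *)
(* to be natural, and no axiom mentions f_0.                                  *)
Record pfister_functor := PfisterFunctor {
  pf_functor :> filtered_functor;
  pf_f : forall (n : nat) (K : fext), Ipow n K -> pf_functor K;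
  pf_f1_res : forall (K L : fext) (h : fhom K L) (q : Ipow 1 K),
    pf_f (Ires h q) = ff_res h (pf_f q);
  pf_inj : forall n (K : fext) (s t : n.-tuple (nz K)),
    \prod_(a <- s) symb_of pf_f a = \prod_(a <- t) symb_of pf_f a
    <-> pfister s = pfister t;
  pf_f_pfister : forall n (K : fext) (t : n.-tuple (nz K)), (0 < n)%N ->
    pf_f (pfister t) = \prod_(a <- t) symb_of pf_f a;
  pf_fD : forall n (K : fext) (q q' : Ipow n K), (0 < n)%N ->
    pf_f (q + q') = pf_f q + pf_f q';
  pf_f_filt : forall n (K : fext) (q : Ipow n K), (0 < n)%N ->
    ff_filt n (pf_f q);
  pf_filt_symb : forall d (K : fext) (x : pf_functor K),
    (forall (L : fext) (h : fhom K L) (a : nz L),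
       ff_filt d.+1 (symb_of pf_f a * ff_res h x)) ->
    ff_filt d x;
  (* alpha is an invariant of Pf_n over K *)
  pf_inv : forall n (K : fext), (0 < n)%N ->
    forall alpha : forall L : fext, fhom K L -> Pf n L -> pf_functor L,
    (forall (L M : fext) (e : fhom K L) (h : fhom L M) (p : Pf n L),
       alpha M (fcomp h e) (Pfres h p) = ff_res h (alpha L e p)) ->
    exists! xy : pf_functor K * pf_functor K,
      forall (L : fext) (e : fhom K L) (p : Pf n L),
        alpha L e p = ff_res e xy.1
                      + ff_res e xy.2 * pf_f (sval p) }.

End Extensions.

Arguments fbase : clear implicits.
Arguments ff_res {k A K L} h : rename.
Arguments ff_filt {k A K} d : rename.
Arguments pf_f {k A} n {K} q : rename.

(* {a} *)
Definition symb (k : fieldType) (A : pfister_functor k) (K : fext k) (a : nz K) : A K :=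
  symb_of (@pf_f k A) a.
Arguments symb {k} A {K} a.

Section Invariants.
Variables (k : fieldType) (A : pfister_functor k) (n : nat).

(* Inv(I^n, A) *)
Record InvI := MkInvI {
  inv_fun :> forall K : fext k, Ipow n K -> A K;
  inv_res : forall (K L : fext k) (h : fhom K L) (q : Ipow n K),
    inv_fun (Ires h q) = ff_res h (inv_fun q) }.

Arguments inv_fun _ K q : clear implicits.

Lemma inv_ext (a b : InvI) : (forall (K : fext k) (q : Ipow n K), a K q = b K q) -> a = b.
Proof.
case: a b => [a ha] [b hb] /= ab.
have eq_ab : a = b.
  by apply: functional_extensionality_dep => K; apply: funext => q.
by subst b; congr MkInvI; apply: Prop_irrelevance.
Qed.

Lemma ff_res_base (K L : fext k) (h : fhom K L) (c : A (fbase k)) :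
  ff_res h (ff_res (fbase_hom K) c) = ff_res (fbase_hom L) c.
Proof.
by rewrite -ff_res_comp; congr (ff_res _ c); apply: fhom_ext => x /=; rewrite fhom_emb.
Qed.

Definition inv_const (c : A (fbase k)) : InvI.
Proof.
by exists (fun K _ => ff_res (fbase_hom K) c) => K L h q; rewrite ff_res_base.
Defined.

Definition inv_scale (c : A (fbase k)) (a : InvI) : InvI.
Proof.
exists (fun K q => ff_res (fbase_hom K) c * a K q) => K L h q.
by rewrite inv_res rmorphM ff_res_base.
Defined.

(* beta = alpha^eps, for eps = 1 or eps = -1 *)
Definition is_shift (eps : int) (alpha beta : InvI) : Prop :=
  forall (K : fext k) (q : Ipow n K) (p : Pf n K),
    alpha K (q + sval p *~ eps) = alpha K q + (pf_f n (sval p) * beta K q) *~ eps.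

(* beta = ~alpha *)
Definition is_tilde (alpha beta : InvI) : Prop :=
  forall (K : fext k) (q : Ipow n K) (mu : nz K),
    alpha K (Wdiag mu *: q) = alpha K q + symb A mu * beta K q.

(* an invariant satisfying P, if there is one *)
Definition pick_inv (P : InvI -> Prop) : InvI :=
  if pselect (exists beta, P beta) is left h then projT1 (cid h) else inv_const 0.

Lemma pick_invP (P : InvI -> Prop) : (exists beta, P beta) -> P (pick_inv P).
Proof. by rewrite /pick_inv; case: pselect => // h _; apply: projT2 (cid h). Qed.

Definition shift_op (eps : int) (alpha : InvI) : InvI := pick_inv (is_shift eps alpha).
Definition tilde_op (alpha : InvI) : InvI := pick_inv (is_tilde alpha).

Lemma symb_eq0 (K : fext k) (x : A K) :
  (forall (L : fext k) (h : fhom K L) (a : nz L), symb A a * ff_res h x = 0) ->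
  x = 0.
Proof.
move=> hx; apply: ff_filt_sep => d; apply: pf_filt_symb => L h a.
by rewrite -/(symb A a) hx; apply: ff_filt_0.
Qed.

Let Wpfister_nz1 (K : fieldType) : Wpfister1 (nz1 K) = 0.
Proof. exact: subrr. Qed.

Hypothesis n_gt0 : (0 < n)%N.

Let Pf0_proof (K : fieldType) : exists t, (0 : Ipow n K) = pfister t.
Proof.
exists [tuple of nseq n (nz1 K)]; apply: val_inj.
by rewrite /= -(prednK n_gt0) big_cons Wpfister_nz1 mul0r.
Qed.

Let Pf0 (K : fieldType) : Pf n K := exist _ 0 (Pf0_proof K).

Let f0 (K : fext k) : pf_f n (0 : Ipow n K) = 0 :> A K.
Proof. by apply: (addIr (pf_f n 0)); rewrite -pf_fD // !add0r. Qed.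

Let shift_inv eps (alpha : InvI) (K : fext k) (q : Ipow n K) : exists! xy : A K * A K,
  forall (L : fext k) (e : fhom K L) (p : Pf n L),
    alpha L (Ires e q + sval p *~ eps)
    = ff_res e xy.1 + ff_res e xy.2 * pf_f n (sval p).
Proof.
apply: (@pf_inv k A n K n_gt0
  (fun L e p => alpha L (Ires e q + sval p *~ eps))) => L M e h p.
by rewrite -inv_res raddfD raddfMz /= Ires_comp.
Qed.

Let mulrz_eps eps : eps = 1 \/ eps = -1 ->
  forall (B : zmodType) (x : B), x *~ eps *~ eps = x.
Proof. by case=> -> B x; rewrite ?mulr1z // !mulrN1z opprK. Qed.

Lemma shift_ex eps alpha :
  eps = 1 \/ eps = -1 -> exists beta, is_shift eps alpha beta.
Proof.
move=> /mulrz_eps epsK; have H := shift_inv eps alpha.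
pose y (K : fext k) (q : Ipow n K) := projT1 (cid (H K q)).
have yP (K : fext k) (q : Ipow n K) := projT2 (cid (H K q)).
have x_def (K : fext k) (q : Ipow n K) : (y K q).1 = alpha K q.
  have [/(_ K (fid K)) + _] := yP K q; rewrite -/(y K q).
  move=> /(_ (Pf0 K)).
  by rewrite /= mul0rz addr0 Ires_id f0 mulr0 addr0 !ff_res_id => <-.
have beta_res (K L : fext k) (h : fhom K L) (q : Ipow n K) :
    (y L (Ires h q)).2 *~ eps = ff_res h ((y K q).2 *~ eps).
  rewrite raddfMz /=; congr (_ *~ _).
  have [_ /(_ (ff_res h (y K q).1, ff_res h (y K q).2))] := yP L (Ires h q).
  rewrite -/(y _ _) => -> // M e p; have [yK _] := yP K q.
  by rewrite /= -!ff_res_comp -yK /= Ires_comp.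
exists (MkInvI beta_res) => K q p; have [/(_ K (fid K) p) + _] := yP K q.
rewrite -/(y K q) Ires_id !ff_res_id x_def => -> /=; congr (_ + _).
by rewrite mulrzAr epsK mulrC.
Qed.

Lemma shiftP eps alpha :
  eps = 1 \/ eps = -1 -> is_shift eps alpha (shift_op eps alpha).
Proof. by move=> heps; apply: (pick_invP (shift_ex alpha heps)). Qed.

Lemma shift_uniq eps alpha beta :
  eps = 1 \/ eps = -1 -> is_shift eps alpha beta -> beta = shift_op eps alpha.
Proof.
move=> heps hb; have hs := shiftP alpha heps.
have epsK := mulrz_eps heps.
apply: inv_ext => K q; have [xy [_ xyU]] := shift_inv eps alpha q.
have key gamma : is_shift eps alpha gamma -> gamma K q *~ eps = xy.2.
  move=> hg; have -> // := xyU (alpha K q, gamma K q *~ eps) _.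
  move=> L e p; rewrite hg raddfMz /= -!inv_res.
  by rewrite mulrzAl [_ * pf_f _ _]mulrC.
by rewrite -[LHS]epsK key // -(key _ hs) epsK.
Qed.

Lemma tilde_ex alpha : exists beta, is_tilde alpha beta.
Proof.
pose F (L : fext k) (p : Pf 1 L) (q : Ipow n L) : A L :=
  alpha L ((1 - val (sval p)) *: q).
have H (K : fext k) (q : Ipow n K) : exists! xy : A K * A K,
    forall (L : fext k) (e : fhom K L) (p : Pf 1 L),
      F L p (Ires e q) = ff_res e xy.1 + ff_res e xy.2 * pf_f 1 (sval p).
  apply: (@pf_inv k A 1 K isT (fun L e p => F L p (Ires e q))) => L M e h p.
  by rewrite /F -inv_res IresZ rmorphB rmorph1 /= Ires_comp.
pose y (K : fext k) (q : Ipow n K) := projT1 (cid (H K q)).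
have yP (K : fext k) (q : Ipow n K) := projT2 (cid (H K q)).
have beta_res (K L : fext k) (h : fhom K L) (q : Ipow n K) :
    (y L (Ires h q)).2 = ff_res h (y K q).2.
  have [_ /(_ (ff_res h (y K q).1, ff_res h (y K q).2))] := yP L (Ires h q).
  rewrite -/(y _ _) => -> // M e p; have [yK _] := yP K q.
  by rewrite /= -!ff_res_comp -yK /= Ires_comp.
pose P1 (K : fext k) (a : nz K) : Pf 1 K :=
  exist _ (pfister [tuple a]) (ex_intro _ [tuple a] erefl).
have P1E (K : fext k) (a : nz K) : 1 - val (sval (P1 K a)) = Wdiag a.
  by rewrite /= big_seq1 /Wpfister1 Wdiag_nz1 opprB addrC subrK.
have yE (K : fext k) (q : Ipow n K) (a : nz K) :
    alpha K (Wdiag a *: q) = (y K q).1 + symb A a * (y K q).2.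
  have [/(_ K (fid K) (P1 K a)) + _] := yP K q.
  by rewrite /F P1E -/(y K q) Ires_id !ff_res_id mulrC.
exists (MkInvI beta_res) => K q a; rewrite yE /=; congr (_ + _).
have := yE K q (nz1 K); rewrite Wdiag_nz1 scale1r => ->.
suff -> : symb A (nz1 K) = 0 by rewrite mul0r addr0.
rewrite /symb /symb_of; suff -> : pfister [tuple nz1 K] = 0.
  by apply: (addIr (pf_f 1 0)); rewrite -pf_fD // !add0r.
by apply: val_inj; rewrite /= big_seq1 Wpfister_nz1.
Qed.

Lemma tildeP alpha : is_tilde alpha (tilde_op alpha).
Proof. exact: (pick_invP (tilde_ex alpha)). Qed.

Lemma tilde_uniq alpha beta : is_tilde alpha beta -> beta = tilde_op alpha.
Proof.
move=> hb; apply: inv_ext => K q; apply/eqP; rewrite -subr_eq0; apply/eqP.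
apply: symb_eq0 => L h a; rewrite rmorphB /= -!inv_res mulrBr.
apply/eqP; rewrite subr_eq0; apply/eqP; apply: (addrI (alpha L (Ires h q))).
by rewrite -hb -tildeP.
Qed.

(* the characterization of the invariants g_n^d; here g_n^{d+1}(0) = 0 is     *)
(* required over all extensions of k                                          *)
Definition is_gfamily (g : nat -> InvI) : Prop :=
  [/\ forall d (K : fext k) (q : Ipow n K), ff_filt (n * d) (g d K q),
      g 0%N = inv_const 1,
      forall d (K : fext k), g d.+1 K 0 = 0,
      forall d, ~~ odd d -> shift_op (-1) (g d.+1) = g d &
      forall d, odd d -> shift_op 1 (g d.+1) = g d].

(* g_n^{d-1}, with g_n^{-1} = 0 *)
Definition gprev (g : nat -> InvI) (d : nat) : InvI :=
  if d is d'.+1 then g d' else inv_const 0.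

End Invariants.

(* delta = delta(A): the restriction of f_1 to I^2 is delta f_2 *)
Definition is_delta (k : fieldType) (A : pfister_functor k) (delta : A (fbase k)) : Prop :=
  forall (K : fext k) (q : Ipow 2 K),
    pf_f 1 (Isub q) = ff_res (fbase_hom K) delta * pf_f 2 q.

(* Main.v *)
Require Import Defs.
From mathcomp Require Import all_boot all_order all_algebra.
From mathcomp Require Import perm boolp ring.

(** Write u = {-1} and let eps be a sign. Expanding alpha(q + eps phi - eps phi)
    with a Pfister element phi gives, since f_n(phi)^2 = u^n f_n(phi),
      alpha^eps = alpha^(-eps) + eps u^n alpha^(eps,-eps)
    (shift_opposite_sub). The heart of the matter is the interaction of the two
    operators, where ~alpha stands for the tilde of alpha:
      (~alpha)^eps = - ~(alpha^(-eps)) - delta alpha^eps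
                     + eps u^(n-1) alpha^(eps,-eps)            (shift_tilde).
    It is found by expanding alpha(<mu>(q + eps phi)) in two ways. One way uses
    the definition of ~alpha first. The other one uses that, for
    phi = <<a>> psi with psi an (n-1)-fold Pfister element,
      <mu> phi = <<mu a>> psi - <<mu>> psi
    is a difference of two n-fold Pfister elements, so that alpha can be shifted
    twice starting from <mu> q. The symbols that appear are simplified with
      {mu a} = {mu} + {a} - delta {mu}{a},   {a}^2 = u {a},   delta u = 2,
    and the resulting equality between multiples of {mu} f_n(phi), valid over
    all extensions, can be divided by that factor (symbs_eq0).

    An invariant is determined by its value at 0 and by one of its two shifts
    (inv_eq_shift), because I^n is additively generated by n-fold Pfister
    elements; this rests on the diagonalization of quadratic forms. Applied to
    alpha = g_n^(d+1), for which alpha^eps = g_n^d and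
    alpha^(eps,-eps) = g_n^(d-1), the formula above expresses the eps-shift of
    ~g_n^(d+1) by g_n^d, g_n^(d-1) and their tildes, and the statement follows
    by induction on d, the two parities being treated together. *)

Set Implicit Arguments.
Unset Strict Implicit.
Unset Printing Implicit Defensive.

Import GRing.Theory.
Local Open Scope ring_scope.

(** * Generators of the Witt ring and of the powers of its fundamental ideal *)

Section WittGenerators.
Variable K : fieldType.

Lemma nzM_proof (a b : nz K) : sval a * sval b != 0.
Proof. by rewrite mulf_neq0 ?(valP a) ?(valP b). Qed.
Definition nzM (a b : nz K) : nz K := exist _ (sval a * sval b) (nzM_proof a b).

Lemma GWform_isometric (q q' : qform K) : isometric q q' -> GWform q = GWform q'.
Proof. by move=> /eq_isoclass qq'; rewrite /GWform qq'. Qed.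

Lemma GWform_perp (q q' : qform K) : GWform (perp q q') = GWform q + GWform q'.
Proof. by rewrite /GWform pi_isoD rmorphD. Qed.

Lemma WdiagM (a b : nz K) : Wdiag (nzM a b) = Wdiag a * Wdiag b.
Proof.
rewrite /Wdiag -rmorphM /= /GWform -rmorphM /= -pi_isoM; congr (Wof _).
apply/GWform_isometric; exists (1%:M : 'M[K]_1), (1%:M : 'M[K]_1).
split; rewrite ?mulmx1 // mul1mx trmx1 mulmx1.
by apply/matrixP=> i j; rewrite /gram /= [LHS]mxE !ord1 /gram /= [RHS]mxE !mxE.
Qed.

Lemma Wdiag_sqr (a : nz K) : Wdiag a * Wdiag a = 1.
Proof.
rewrite -WdiagM -Wdiag_nz1 /Wdiag; congr (Wof _); apply/GWform_isometric.
have aV : sval a * (sval a)^-1 = 1 by rewrite divff ?(valP a).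
exists ((sval a)%:M : 'M[K]_1), ((sval a)^-1%:M : 'M[K]_1); rewrite /gram /=.
split; rewrite -?scalar_mxM ?[_^-1 * _]mulrC ?aV //.
by rewrite tr_scalar_mx -scalar_mxM mulr1.
Qed.

(** Multiplying an n-fold Pfister element by <mu> gives a difference of two
    n-fold Pfister elements, because <mu> - <mu a> = <<mu a>> - <<mu>>. *)
Lemma scale_pfister m (mu a : nz K) (s : m.-tuple (nz K)) :
  Wdiag mu *: pfister [tuple of a :: s]
  = pfister [tuple of nzM mu a :: s] - pfister [tuple of mu :: s].
Proof.
apply: val_inj; rewrite /= !big_cons /Wpfister1 WdiagM Wdiag_nz1 /GRing.scale /=.
by ring.
Qed.

Hypothesis two_neq0 : (2 : K) != 0.

Lemma WdiagN1 : Wdiag (nzN (nz1 K)) = -1.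
Proof.
apply/eqP; rewrite -subr_eq0 opprK addrC -Wdiag_nz1 -rmorphD /= -GWform_perp.
apply/eqP/Wof_eq0; exists 1; rewrite mul1r; apply/GWform_isometric.
(* The rows of P, (1, 1/2) and (1, -1/2), are orthogonal in the hyperbolic
   plane and have norms 1 and -1. *)
have half : (2 : K)^-1 + 2^-1 = 1 by apply: (mulIf two_neq0); rewrite mulrDl mulVf // mul1r.
pose P : 'M[K]_(1 + 1) := block_mx 1%:M (2^-1)%:M 1%:M (- 2^-1)%:M.
pose P' : 'M[K]_(1 + 1) := block_mx (2^-1)%:M (2^-1)%:M 1%:M (-1)%:M.
have PP' : P *m P' = 1%:M.
  rewrite /P /P' mulmx_block !mul1mx !mulmx1 -!scalar_mxM !mulrN1 opprK -!raddfD /=.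
  by rewrite half subrr raddf0 (scalar_mx_block 1 1).
exists P, P'; split=> //; first exact: mulmx1C.
rewrite /gram /= /P tr_block_mx !tr_scalar_mx !mulmx_block.
rewrite !mulmx0 !mulmx1 !add0r !addr0 !mul1mx.
by rewrite -!raddfD /= half addrN addNr raddf0.
Qed.

(** A nonzero symmetric bilinear form represents a nonzero value by polarization:
    if the basis vectors e_i and e_j are isotropic, then e_i + e_j takes the value
    2 G i j. The vector is then moved to the first place of a basis. *)
Lemma symmetric_mx_anisotropic n (G : 'M[K]_n.+1) :
  G^T = G -> G != 0 ->
  exists2 P, P \in unitmx & (P *m G *m P^T) 0 0 != 0.
Proof.
move=> GT G0.
have diagP (H : 'M[K]_n.+1) i : H i i != 0 ->
    exists2 P, P \in unitmx & (P *m H *m P^T) 0 0 != 0.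
  move=> Hii; exists (tperm_mx 0 i); first exact: unitmx_perm.
  by rewrite tr_tperm_mx -xcolE -xrowE !mxE tpermL.
have [i|diag0] := pickP (fun i => G i i != 0); first exact: diagP.
have [[i j] /= Gij|G0'] := pickP (fun ij => G ij.1 ij.2 != 0); last first.
  case/negP: G0; apply/eqP/matrixP=> i j; rewrite mxE.
  exact/eqP/negbFE/(G0' (i, j)).
have neq_ij : i != j by apply: contraNneq Gij => ->; apply: negbFE (diag0 j).
pose T : 'M[K]_n.+1 := 1%:M + delta_mx i j.
have T_unit : T \in unitmx.
  suff: T *m (1%:M - delta_mx i j) = 1%:M by case/mulmx1_unit.
  rewrite mulmxBr mulmx1 mulmxDl mul1mx mul_delta_mx_cond.
  by rewrite eq_sym (negbTE neq_ij) mulr0n addr0 addrK.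
have TE (X : 'M[K]_n.+1) b : (T *m X) i b = X i b + X j b.
  rewrite mulmxDl mul1mx !mxE (bigD1 j) //= big1 => [|c /negPf cj].
    by rewrite mxE !eqxx mul1r addr0.
  by rewrite mxE cj andbF mul0r.
have [|P P_unit PG] := diagP (T *m G *m T^T) i.
  have -> : T *m G *m T^T = T *m (T *m G)^T by rewrite trmx_mul GT mulmxA.
  have trE (X : 'M[K]_n.+1) a b : X^T a b = X b a by rewrite mxE.
  rewrite TE !trE !TE.
  have G00 c : G c c = 0 by apply/eqP/negbFE/diag0.
  have Gji : G j i = G i j by rewrite -[in LHS]GT trE.
  rewrite !G00 add0r addr0 Gji -mulr2n -mulr_natl.
  by rewrite mulf_neq0.
exists (P *m T); first by rewrite unitmx_mul P_unit.
by rewrite trmx_mul !mulmxA in PG *.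
Qed.

(** One Gram-Schmidt step: the line spanned by an anisotropic vector splits off
    as an orthogonal summand. *)
Lemma symmetric_mx_split n (G : 'M[K]_(1 + n)) :
  G^T = G -> G != 0 ->
  exists P (a : K) (D : 'M[K]_n), [/\ P \in unitmx, a != 0 &
    P *m G *m P^T = block_mx (a%:M : 'M_1) 0 0 D].
Proof.
move=> GT G0; have [P P_unit] :
    exists2 P : 'M[K]_(1 + n), P \in unitmx & (P *m G *m P^T) 0 0 != 0.
  exact: symmetric_mx_anisotropic GT G0.
(* H stays abstract, so that mxE reads its entries without unfolding the product. *)
have [H defH] : exists H, H = P *m G *m P^T by exists (P *m G *m P^T).
rewrite -defH; set a : K := H 0 0 => a0.
have HT : H^T = H by rewrite defH !trmx_mul trmxK GT mulmxA.
pose r : 'rV[K]_n := ursubmx H.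
pose L : 'M_(1 + n) := block_mx 1%:M 0 (- (a^-1 *: r^T)) 1%:M.
have HE : H = block_mx (a%:M : 'M_1) r r^T (drsubmx H).
  rewrite /r trmx_ursub HT -[LHS](@submxK K 1 n 1 n); f_equal.
  rewrite [LHS]mx11_scalar !mxE; f_equal.
  by rewrite /a; congr (H _ _); apply: val_inj.
have L_unit : L \in unitmx by rewrite unitmxE det_lblock !det1 mulr1 unitr1.
exists (L *m P), a, (drsubmx H - a^-1 *: r^T *m r).
split; rewrite ?unitmx_mul ?L_unit //.
have -> : L *m P *m G *m (L *m P)^T = L *m H *m L^T.
  by rewrite defH trmx_mul !mulmxA.
rewrite {1}HE /L tr_block_mx !mulmx_block.
rewrite !raddfN /= !linearZ /= !trmx0 !trmx1 !trmxK.
rewrite !mul0mx !mul1mx !mulmx0 !mulmx1 !addr0 ?add0r.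
have rK : a^-1 *: - r^T *m a%:M + r^T = 0.
  by rewrite mul_mx_scalar scalerA divff // scale1r addNr.
congr block_mx; rewrite ?rK //.
- by rewrite mul_scalar_mx scalerN scalerA mulVf // scale1r addNr.
- by rewrite mul0mx oppr0 scaler0 add0r scalerN mulNmx addrC.
Qed.

Lemma GWform_diag (q : qform K) :
  exists s : seq (nz K), GWform q = \sum_(a <- s) GWform (form1 a).
Proof.
suff H n (G : 'M[K]_n) hG :
    exists s : seq (nz K), GWform (@mkQform K n G hG) = \sum_(a <- s) GWform (form1 a).
  by case: q => -[n G] hG; apply: (H n G).
elim: n G hG => [|n IHn] G hG.
  exists [::]; rewrite big_nil -(rmorph0 (@groth_of (isoclass K))) -pi_form0.
  apply/GWform_isometric; exists 1%:M, 1%:M.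
  by split; rewrite ?mulmx1 //; apply/matrixP=> -[].
have [/eqP GT G_unit] := andP hG.
have G0 : G != 0 by apply: contraTneq G_unit => ->; rewrite unitmxE det0 unitr0.
have [P [a [D [P_unit a0 PG]]]] := symmetric_mx_split GT G0.
have hD : (D^T == D) && (D \in unitmx).
  apply/andP; split.
    have : (P *m G *m P^T)^T = P *m G *m P^T by rewrite !trmx_mul trmxK GT mulmxA.
    by rewrite PG tr_block_mx => /eq_block_mx[_ _ _ ->].
  have : P *m G *m P^T \in unitmx by rewrite !unitmx_mul unitmx_tr P_unit G_unit.
  by rewrite PG !unitmxE det_ublock unitrM => /andP[].
have [s Ds] := IHn D hD; exists (exist _ a a0 :: s).
rewrite big_cons -Ds -GWform_perp; apply/esym/GWform_isometric.
exists P, (invmx P); split; [exact: mulmxV | exact: mulVmx | exact: PG].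
Qed.

Lemma Wpfister1_N1 : Wpfister1 (nzN (nz1 K)) = 2.
Proof. by rewrite /Wpfister1 WdiagN1 Wdiag_nz1 opprK. Qed.

(** From <a> = 1 - <<a>>, an element of even dimension is a combination of the
    <<a>> plus an even integer, and 2 = <<-1>>. *)
Lemma fund_ideal_gen (w : W K) : fund_ideal w ->
  exists s t : seq (nz K), w = \sum_(a <- s) Wpfister1 a - \sum_(a <- t) Wpfister1 a.
Proof.
case=> x x_even ->; have [q [q' Dx]] := GW_sub x; move: x_even; rewrite Dx {x Dx}.
have [s ->] := GWform_diag q; have [t ->] := GWform_diag q'.
have dimE (r : seq (nz K)) : vdim (\sum_(a <- r) GWform (form1 a)) = (size r)%:Z.
  elim: r => [|a r IHr]; first by rewrite big_nil rmorph0.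
  by rewrite big_cons rmorphD /= IHr vdimE.
have sumE (r : seq (nz K)) : Wof (\sum_(a <- r) GWform (form1 a))
    = (size r)%:R - \sum_(a <- r) Wpfister1 a.
  elim: r => [|a r IHr]; first by rewrite !big_nil subr0 rmorph0.
  by rewrite !big_cons rmorphD /= IHr /Wpfister1 Wdiag_nz1 -natr1 /Wdiag; ring.
rewrite rmorphB /= !dimE rmorphB /= !sumE => st_even.
have /dvdnP[h Dh] : (2 %| size s + size t)%N.
  suff: (2 %| (size s + size t)%:Z)%Z by [].
  case/dvdzP: st_even => j Ej; apply/dvdzP; exists (j + (size t)%:Z).
  by rewrite mulrDl -Ej PoszD; ring.
(* size s - size t = 2 h - 2 (size t), and each 2 is written <<-1>>. *)
exists (nseq h (nzN (nz1 K)) ++ t), (nseq (size t) (nzN (nz1 K)) ++ s).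
have sumN1 m : \sum_(a <- nseq m (nzN (nz1 K))) Wpfister1 a = m%:R * 2.
  by rewrite big_nseq iter_addr addr0 Wpfister1_N1 mulr_natl.
have -> : (size s)%:R = h%:R * 2 - (size t)%:R :> W K.
  by rewrite -natrM -Dh natrD addrK.
by rewrite !big_cat /= !sumN1; ring.
Qed.

(** The n-th power of I is the additive group generated by the n-fold products of
    the <<a>>. The generality in P is what the induction on n uses: for n + 1 the
    induction hypothesis is applied to the property P (<<a>> * _). *)
Lemma ideal_pow_ind n (P : W K -> Prop) : (0 < n)%N ->
  P 0 -> (forall x y, P x -> P y -> P (x - y)) ->
  (forall t : n.-tuple (nz K), P (\prod_(a <- t) Wpfister1 a)) ->
  forall w, ideal_pow (@fund_ideal K) n w -> P w.
Proof.
case: n => // n _; elim: n => [|n IHn] in P * => P0 PB Ppf w [s hs ->].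
all: have PD x y : P x -> P y -> P (x + y) by
       move=> Px Py; rewrite -[y]opprK -[- y]sub0r; apply: (PB _ _ Px); exact: PB.
all: have Psum T (r : seq T) F : (forall i, P (F i)) -> P (\sum_(i <- r) F i) by
       move=> PF; apply: big_ind.
all: rewrite big_seq; apply: big_ind => // -[x y] /hs[/= Ix Iy].
  have [|s1 [s2 ->]] := @fund_ideal_gen (x * y); first by rewrite mulrC; apply: fund_idealM.
  by apply: PB; apply: Psum => a; have := Ppf [tuple a]; rewrite big_seq1.
have [s1 [s2 ->]] := fund_ideal_gen Ix.
suff Pa a : P (Wpfister1 a * y) by rewrite mulrBl !mulr_suml; apply: PB; apply: Psum.
apply: (IHn (fun w => P (Wpfister1 a * w))) => //; first by rewrite mulr0.
  by move=> u v Pu Pv; rewrite mulrBr; apply: PB.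
by move=> t; have := Ppf [tuple of a :: t]; rewrite big_cons.
Qed.

Lemma Ipow_ind n (P : Ipow n K -> Prop) : (0 < n)%N ->
  P 0 -> (forall x y, P x -> P y -> P (x - y)) ->
  (forall t : n.-tuple (nz K), P (pfister t)) ->
  forall q, P q.
Proof.
move=> n_gt0 P0 PB Ppf q.
have [] // := @ideal_pow_ind n (fun w => exists2 v : Ipow n K, val v = w & P v)
  n_gt0 _ _ _ (val q).
- by exists 0.
- by move=> _ _ [x <- Px] [y <- Py]; exists (x - y) => //; apply: PB.
- by move=> t; exists (pfister t).
- exact/asboolP/(valP q).
- by move=> v /val_inj ->.
Qed.

End WittGenerators.

(** * Symbols *)

Section Symbols.
Variables (k : fieldType) (A : pfister_functor k).

Lemma ff_res_symb (K L : fext k) (h : fhom K L) (a : nz K) :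
  ff_res h (symb A a) = symb A (nzmap h a).
Proof.
rewrite /symb /symb_of -pf_f1_res Ires_pfister.
by congr (pf_f 1 (pfister _)); apply: val_inj.
Qed.

Lemma pf_f_0 n (K : fext k) : (0 < n)%N -> pf_f n (0 : Ipow n K) = 0 :> A K.
Proof. by move=> n_gt0; apply: (addIr (pf_f n 0)); rewrite -pf_fD // !add0r. Qed.

Lemma pf_f_N n (K : fext k) (q : Ipow n K) :
  (0 < n)%N -> pf_f n (- q) = - pf_f n q :> A K.
Proof.
by move=> n_gt0; apply/eqP; rewrite -addr_eq0 -pf_fD // addNr pf_f_0.
Qed.

Lemma ff_res_symbN1 (K L : fext k) (h : fhom K L) :
  ff_res h (symb A (nzN (nz1 K))) = symb A (nzN (nz1 L)).
Proof.
by rewrite ff_res_symb; congr (symb A _); apply: val_inj; rewrite /= rmorphN rmorph1.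
Qed.

(** A product of n symbols with freely chosen entries behaves like a
    regular element, provided that the entries range over all extensions. *)
Lemma symbs_eq0 n (K : fext k) (x : A K) :
  (forall (L : fext k) (h : fhom K L) (s : seq (nz L)), size s = n ->
     \prod_(a <- s) symb A a * ff_res h x = 0) ->
  x = 0.
Proof.
elim: n K x => [|n IHn] K x hx.
  by have := hx K (fid K) [::] erefl; rewrite big_nil mul1r ff_res_id.
apply: symb_eq0 => L h a; apply: IHn => M g s sn.
have := hx M (fcomp g h) (nzmap g a :: s); rewrite /= sn => /(_ erefl).
by rewrite big_cons rmorphM ff_res_comp /= ff_res_symb mulrCA mulrA.
Qed.

Hypothesis hk : 2%N \notin [pchar k].

Lemma fext_two_neq0 (K : fext k) : (2 : K) != 0.
Proof. by move: hk; rewrite -(fmorph_pchar (fext_emb K)) inE. Qed.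

(** The symbol of a Pfister element depends only on its class, and
    <<a>>^2 = 2 - 2<a> = <<-1>><<a>>. *)
Lemma symb_sqr (K : fext k) (a : nz K) :
  symb A a * symb A a = symb A (nzN (nz1 K)) * symb A a.
Proof.
have [_] := @pf_inj k A 2 K [tuple a; a] [tuple nzN (nz1 K); a].
rewrite !big_cons !big_nil !mulr1; apply; apply: val_inj => /=.
rewrite !big_cons !big_nil !mulr1 Wpfister1_N1 ?fext_two_neq0 // /Wpfister1 Wdiag_nz1.
by have aa := Wdiag_sqr a; rewrite mulrBr mulr1 !mulrBl aa; ring.
Qed.

Lemma symbs_sqr (K : fext k) (s : seq (nz K)) :
  \prod_(a <- s) symb A a * \prod_(a <- s) symb A a
  = symb A (nzN (nz1 K)) ^+ size s * \prod_(a <- s) symb A a.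
Proof.
elim: s => [|a s IHs]; first by rewrite !big_nil expr0.
by rewrite !big_cons mulrACA symb_sqr IHs exprS mulrACA.
Qed.

Variables (delta : A (fbase k)) (hdelta : is_delta delta).

(** f_1 is applied to <<ab>> = <<a>> + <<b>> - <<a,b>>, whose last term lies in
    I^2, where f_1 is delta f_2. *)
Lemma symbM (K : fext k) (a b : nz K) :
  symb A (nzM a b)
  = symb A a + symb A b - ff_res (fbase_hom K) delta * (symb A a * symb A b).
Proof.
have := hdelta (pfister [tuple a; b]); rewrite pf_f_pfister //.
rewrite !big_cons big_nil mulr1 -/(symb A a) -/(symb A b) => <-.
rewrite /symb /symb_of -pf_f_N // -!pf_fD //; congr (pf_f 1 _); apply: val_inj => /=.
rewrite !big_cons !big_nil !mulr1 /Wpfister1 WdiagM Wdiag_nz1; ring.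
Qed.

(** As a^2 is a square, 0 = {a^2} = 2{a} - delta {a}^2 = (2 - delta {-1}){a} for
    every a. *)
Lemma delta_symbN1 (K : fext k) :
  ff_res (fbase_hom K) delta * symb A (nzN (nz1 K)) = 2.
Proof.
apply/eqP; rewrite -subr_eq0; apply/eqP; apply: symb_eq0 => L h a.
rewrite rmorphB rmorphM /= ff_res_base ff_res_symbN1 rmorph_nat.
have aa0 : symb A (nzM a a) = 0.
  rewrite /symb /symb_of (_ : pfister _ = 0) ?pf_f_0 //; apply: val_inj => /=.
  by rewrite big_seq1 /Wpfister1 WdiagM Wdiag_sqr Wdiag_nz1 subrr.
have := symbM a a; rewrite aa0 symb_sqr => E.
by apply/eqP; rewrite -[X in _ == X]oppr0 [X in _ == - X]E; apply/eqP; ring.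
Qed.

End Symbols.

(** * The two operators on invariants *)

Section Invariants.
Variables (k : fieldType) (A : pfister_functor k) (n : nat).
Hypothesis n_gt0 : (0 < n)%N.
Implicit Types al be ga si : InvI A n.

Lemma shift_pfister eps al be (K : fext k) (q : Ipow n K) (t : n.-tuple (nz K)) :
  is_shift eps al be ->
  al K (q + pfister t *~ eps)
  = al K q + eps%:~R * (\prod_(a <- t) symb A a * be K q).
Proof.
move=> hs; have /= := hs K q (exist _ (pfister t) (ex_intro _ t erefl)).
by rewrite pf_f_pfister // mulrzl.
Qed.

(** Evaluate alpha at q = (q - eps phi) + eps phi by two successive shifts; the
    square of f_n(phi) produces the power of {-1}. *)
Lemma shift_opposite_sub eps al be be' ga :
  2%N \notin [pchar k] ->
  eps = 1 \/ eps = -1 ->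
  is_shift eps al be -> is_shift (- eps) al be' -> is_shift (- eps) be ga ->
  forall (K : fext k) (q : Ipow n K),
    be K q = be' K q + eps%:~R * (symb A (nzN (nz1 K)) ^+ n * ga K q).
Proof.
move=> hk heps hb hb' hg K q; apply/eqP; rewrite -subr_eq0; apply/eqP.
apply: (@symbs_eq0 k A n) => L h s sn.
rewrite !(rmorphB, rmorphD, rmorphM, rmorphXn, rmorph_int) /= ff_res_symbN1 -!inv_res.
pose t : n.-tuple (nz L) := tcast sn (in_tuple s).
have ts : t = s :> seq _ by rewrite val_tcast.
set Q := Ires h q; have := shift_pfister (Q + pfister t *~ - eps) t hb.
rewrite -[X in al L X]addrA -mulrzDr addNr mulr0z addr0.
rewrite (shift_pfister Q t hb') (shift_pfister Q t hg) ts.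
have := @symbs_sqr k A hk L s; rewrite sn.
set p := \prod_(a <- s) _ => p2 E.
transitivity (eps%:~R * (al L Q + (- eps)%:~R * (p * be' L Q)
    + eps%:~R * (p * (be L Q + (- eps)%:~R * (p * ga L Q))) - al L Q)
  + eps%:~R * ga L Q * (p * p - symb A (nzN (nz1 L)) ^+ n * p)).
  by case: heps => ->; ring.
by rewrite -E p2 !subrr !mulr0 addr0.
Qed.

Lemma tilde_affine al be ga (c : A (fbase k)) :
  (forall (K : fext k) (q : Ipow n K),
     al K q = be K q + ff_res (fbase_hom K) c * ga K q) ->
  forall (K : fext k) (q : Ipow n K),
    tilde_op al K q
    = tilde_op be K q + ff_res (fbase_hom K) c * tilde_op ga K q.
Proof.
move=> E K q; apply/eqP; rewrite -subr_eq0; apply/eqP; apply: symb_eq0 => L h a.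
rewrite !(rmorphB, rmorphD, rmorphM) /= ff_res_base -!inv_res.
have := E L (Wdiag a *: Ires h q); rewrite !tildeP !E => E'.
transitivity (be L (Ires h q) + ff_res (fbase_hom L) c * ga L (Ires h q)
    + symb A a * tilde_op al L (Ires h q)
  - (be L (Ires h q) + symb A a * tilde_op be L (Ires h q)
     + ff_res (fbase_hom L) c *
       (ga L (Ires h q) + symb A a * tilde_op ga L (Ires h q)))); first by ring.
by rewrite -E' subrr.
Qed.

End Invariants.

(** The ring computation behind shift_tilde. The letters stand for
    e = eps, u = {-1}, um = u^(n-1), m = {mu}, a = {a}, del = delta, p is the product
    of the n - 1 symbols of psi, so that a p = f_n(phi), and b, b', c, s are the values at q
    of alpha^eps, alpha^(-eps), alpha^(eps,-eps) and (~alpha)^eps; a prefix t marks the tilde of the corresponding invariant. *)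
Lemma tilde_shift_identity (R : comPzRingType) (e u del m a p um b b' c tb tb' tc s : R) :
  e = 1 \/ e = -1 -> m * m = u * m -> p * p = um * p -> del * u = 2 ->
  b = b' + e * (u * um * c) -> tb = tb' + e * (u * um * tc) ->
  e * (a * p * b) + m * (e * (a * p * s))
  = e * ((m + a - del * (m * a)) * p * (b + m * tb - e * (m * p * (c + m * tc))))
    - e * (m * p * (b' + m * tb')) ->
  m * (a * p) * (s + tb' + del * b - e * (um * c)) = 0.
Proof.
move=> e1 m2 p2 du Db Dtb E.
pose C := c + m * tc; pose X := m + a - del * (m * a).
(* The conclusion is a combination of the hypotheses; the cofactors come from
   reducing p * p, m * m and del * u in the last equation, in this order. *)
transitivity (e * ((e * (a * p * b) + m * (e * (a * p * s)))
    - (e * (X * p * (b + m * tb - e * (m * p * C))) - e * (m * p * (b' + m * tb'))))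
  + e * (X * m * C * (um * p - p * p)
    + (m * m - u * m) * (del * (a * p * um * C) - p * um * C
                         - e * (del * (a * p * tb)) + a * p * um * tc)
    + (del * u - 2) * (m * (a * p) * (um * C - e * tb)))).
  by rewrite {}/C {}/X Db Dtb; case: e1 => ->; ring.
by rewrite E p2 m2 du !subrr !(mul0r, mulr0, addr0).
Qed.

(** Two expansions of alpha(<mu>(q + eps phi)) with phi = <<a>> psi are compared.
    The relation is obtained up to the factor {mu} f_n(phi), a product of n + 1
    symbols, which cancels by symbs_eq0. *)
Lemma shift_tilde (k : fieldType) (A : pfister_functor k) (m : nat)
  (hk : 2%N \notin [pchar k]) (delta : A (fbase k)) (hdelta : is_delta delta)
  eps (al be be' ga si : InvI A m.+1) :
  eps = 1 \/ eps = -1 ->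
  is_shift eps al be -> is_shift (- eps) al be' -> is_shift (- eps) be ga ->
  is_shift eps (tilde_op al) si ->
  forall (K : fext k) (q : Ipow m.+1 K),
    si K q = - tilde_op be' K q - ff_res (fbase_hom K) delta * be K q
             + eps%:~R * (symb A (nzN (nz1 K)) ^+ m * ga K q).
Proof.
move=> heps hb hb' hg hs K q.
suff E : si K q + tilde_op be' K q + ff_res (fbase_hom K) delta * be K q
         - eps%:~R * (symb A (nzN (nz1 K)) ^+ m * ga K q) = 0.
  by rewrite -[LHS]addr0 -[X in _ + X]oppr0 -E; ring.
apply: (@symbs_eq0 k A m.+2) => L h [|mu [|a s]] //= [sm].
rewrite !(rmorphB, rmorphD, rmorphM, rmorphXn, rmorph_int) /= ff_res_symbN1.
rewrite ff_res_base -!inv_res; move: (Ires h q) => {K h}q.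
have {sm} [t <-] : exists t : m.-tuple (nz L), t = s :> seq _.
  by exists (tcast sm (in_tuple s)); rewrite val_tcast.
rewrite !big_cons.
have hsum := shift_opposite_sub (ltn0Sn m) hk heps hb hb' hg.
have htsum : forall (K : fext k) (q : Ipow m.+1 K),
    tilde_op be K q = tilde_op be' K q
      + eps%:~R * (symb A (nzN (nz1 K)) ^+ m.+1 * tilde_op ga K q).
  pose c : A (fbase k) := eps%:~R * symb A (nzN (nz1 (fbase k))) ^+ m.+1.
  have cE (K : fext k) : ff_res (fbase_hom K) c
      = eps%:~R * symb A (nzN (nz1 K)) ^+ m.+1.
    by rewrite rmorphM rmorph_int rmorphXn /= ff_res_symbN1.
  move=> K q'; rewrite mulrA -cE; apply: tilde_affine => K' q''.
  by rewrite cE -mulrA; apply: hsum.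
apply: (@tilde_shift_identity _ eps%:~R (symb A (nzN (nz1 L)))
  (ff_res (fbase_hom L) delta) (symb A mu) (symb A a)
  (\prod_(j <- t) symb A j) (symb A (nzN (nz1 L)) ^+ m)
  (be L q) (be' L q) _ (tilde_op be L q) (tilde_op be' L q) (tilde_op ga L q)).
- by case: heps => ->; [left | right; rewrite mulrN1z].
- exact: symb_sqr.
- by rewrite symbs_sqr // size_tuple.
- exact: delta_symbN1.
- by rewrite -exprS hsum.
- by rewrite -exprS htsum.
pose tm := [tuple of mu :: t]; pose tma := [tuple of nzM mu a :: t].
pose ta := [tuple of a :: t].
(* The right-hand side is reached from <mu> q by a shift of sign -eps, followed by
   a shift of sign eps. *)
have E0 : Wdiag mu *: (q + pfister ta *~ eps)
    = Wdiag mu *: q + pfister tm *~ - eps + pfister tma *~ eps.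
  by rewrite scalerDr -scalerMzr scale_pfister mulrzBl mulrNz addrAC addrA.
have := tildeP al (q + pfister ta *~ eps) mu; rewrite E0.
have n0 := ltn0Sn m.
rewrite (shift_pfister n0 _ tma hb) (shift_pfister n0 _ tm hb') (shift_pfister n0 _ tm hg).
rewrite (shift_pfister n0 _ ta hs) (shift_pfister n0 _ ta hb) !tildeP.
rewrite !big_cons (symbM hdelta) => E.
apply/eqP; rewrite -subr_eq0; have /eqP := E; rewrite -subr_eq0 => /eqP {}E.
by apply/eqP; rewrite -oppr0 -E; ring.
Qed.

Section Determination.
Variables (k : fieldType) (A : pfister_functor k) (n : nat).
Hypotheses (hk : 2%N \notin [pchar k]) (n_gt0 : (0 < n)%N).

(** The difference of al and al' is invariant under translation by Pfister
    elements, hence constant, as these generate I^n. *)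
Lemma inv_eq_shift eps (al al' be : InvI A n) :
  eps = 1 \/ eps = -1 -> is_shift eps al be -> is_shift eps al' be ->
  (forall K : fext k, al K 0 = al' K 0) -> al = al'.
Proof.
move=> heps hs hs' h0; apply: inv_ext => K q.
pose D (x : Ipow n K) := al K x - al' K x.
have Dper : forall v x, D (x + v) = D x.
  apply: (@Ipow_ind K (fext_two_neq0 hk K)) => // [x|v w Dv Dw x|t x].
  - by rewrite addr0.
  - by rewrite addrCA addrC Dv -(Dw (x - w)) addrNK.
  have Deps y : D (y + pfister t *~ eps) = D y.
    by rewrite /D (shift_pfister n_gt0 _ t hs) (shift_pfister n_gt0 _ t hs'); ring.
  by case: heps Deps => -> Deps; [have := Deps x | have := Deps (x + pfister t)];
    rewrite ?mulr1z // mulrN1z addrK.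
by apply/eqP; rewrite -subr_eq0 -/(D q) -[q]add0r Dper /D h0 subrr.
Qed.

End Determination.

(** * The invariants g_n^d *)

Section GFamily.
Variables (k : fieldType) (A : pfister_functor k) (n : nat).

Lemma shift_const eps (c : A (fbase k)) :
  is_shift eps (inv_const n c) (inv_const n 0).
Proof. by move=> K q p; rewrite /= rmorph0 mulr0 mul0rz addr0. Qed.

Lemma tilde_const (c : A (fbase k)) : tilde_op (inv_const n c) = inv_const n 0.
Proof. by apply/esym/tilde_uniq => K q mu; rewrite /= rmorph0 mulr0 addr0. Qed.

Lemma scale_const0 (c : A (fbase k)) : inv_scale c (inv_const n 0) = inv_const n 0.
Proof. by apply: inv_ext => K q; rewrite /= rmorph0 mulr0. Qed.

Lemma shift_scale eps (c : A (fbase k)) (al be : InvI A n) :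
  is_shift eps al be -> is_shift eps (inv_scale c al) (inv_scale c be).
Proof. by move=> hs K q p; rewrite /= hs mulrDr mulrzAr mulrCA. Qed.

(** Scaling fixes the zero form, so the correction term vanishes there. *)
Lemma tilde_at0 (al : InvI A n) (K : fext k) : tilde_op al K 0 = 0.
Proof.
apply: symb_eq0 => L h a; rewrite -inv_res raddf0.
by apply: (addrI (al L 0)); rewrite -tildeP scaler0 addr0.
Qed.

(** The sign of the shift that sends g_n^(d+1) to g_n^d. *)
Definition gsign (d : nat) : int := if odd d then 1 else -1.

Lemma gsignP d : gsign d = 1 \/ gsign d = -1.
Proof. by rewrite /gsign; case: odd; [left | right]. Qed.

Lemma gsignS d : gsign d.+1 = - gsign d.
Proof. by rewrite /gsign /=; case: odd; rewrite ?opprK. Qed.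

Hypothesis n_gt0 : (0 < n)%N.
Variables (g : nat -> InvI A n) (hg : is_gfamily g).

Lemma gfamily_shift d : is_shift (gsign d) (g d.+1) (g d).
Proof.
have [_ _ _ g_even g_odd] := hg; have := shiftP n_gt0 (g d.+1) (gsignP d).
by rewrite /gsign; case: (boolP (odd d)) => [/g_odd -> | /g_even ->].
Qed.

(** The signs alternate, so two successive shifts of g_n^(d+1) have opposite
    signs, as shift_opposite_sub and shift_tilde require. *)
Lemma gprev_shift d : is_shift (- gsign d) (g d) (gprev g d).
Proof.
case: d => [|d]; last by rewrite gsignS opprK; apply: gfamily_shift.
by have [_ -> _ _ _] := hg; apply: shift_const.
Qed.

End GFamily.

Section TildeGFamily.
Variables (k : fieldType) (A : pfister_functor k) (m : nat).
Hypothesis hk : 2%N \notin [pchar k].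
Variables (delta : A (fbase k)) (hdelta : is_delta delta).
Variables (g : nat -> InvI A m.+1) (hg : is_gfamily g).
Local Notation u K := (symb A (nzN (nz1 K))).

Lemma gfamily_opposite_shift d be' : is_shift (- gsign d) (g d.+1) be' ->
  forall (K : fext k) (q : Ipow m.+1 K),
    be' K q = g d K q - (gsign d)%:~R * (u K ^+ m.+1 * gprev g d K q).
Proof.
move=> hb' K q.
rewrite (shift_opposite_sub (ltn0Sn m) hk (gsignP d)
  (gfamily_shift (ltn0Sn m) hg d) hb' (gprev_shift (ltn0Sn m) hg d)).
by rewrite addrK.
Qed.

Lemma shift_tilde_gfamily d si : is_shift (gsign d) (tilde_op (g d.+1)) si ->
  forall (K : fext k) (q : Ipow m.+1 K),
    si K q = - tilde_op (g d) K q
             + (gsign d)%:~R * (u K ^+ m.+1 * tilde_op (gprev g d) K q)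
             - ff_res (fbase_hom K) delta * g d K q
             + (gsign d)%:~R * (u K ^+ m * gprev g d K q).
Proof.
move=> hs K q.
have [be' hb'] := shift_ex (ltn0Sn m) (g d.+1) (gsignP d.+1).
rewrite gsignS in hb'.
rewrite (shift_tilde hk hdelta (gsignP d) (gfamily_shift (ltn0Sn m) hg d)
  hb' (gprev_shift (ltn0Sn m) hg d) hs).
pose c : A (fbase k) := - (gsign d)%:~R * u (fbase k) ^+ m.+1.
have cE (L : fext k) : ff_res (fbase_hom L) c = - (gsign d)%:~R * u L ^+ m.+1.
  by rewrite rmorphM rmorphN rmorph_int rmorphXn /= ff_res_symbN1.
rewrite (@tilde_affine k A m.+1 be' (g d) (gprev g d) c) => [|L x].
  by rewrite cE; ring.
by rewrite (gfamily_opposite_shift hb') cE; ring.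
Qed.

(** The eps-shifts of both sides are compared for eps = -1; they agree because
    delta u = 2. *)
Lemma tilde_gfamily_odd j : ~~ odd j ->
  tilde_op (g j) = inv_scale (u (fbase k) ^+ m) (gprev g j) ->
  tilde_op (gprev g j) = inv_scale (- delta) (gprev g j) ->
  tilde_op (g j.+1) = inv_scale (- delta) (g j.+1).
Proof.
move=> j_even Tj Tj'; have [_ _ gS0 _ _] := hg.
have [si hs] := shift_ex (ltn0Sn m) (tilde_op (g j.+1)) (gsignP j).
apply: (inv_eq_shift hk (ltn0Sn m) (gsignP j) hs); last first.
  by move=> K; rewrite tilde_at0 /= gS0 mulr0.
suff -> : si = inv_scale (- delta) (g j) by apply/shift_scale/gfamily_shift.
apply: inv_ext => K q; rewrite (shift_tilde_gfamily hs) Tj Tj' /gsign (negbTE j_even).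
rewrite /= !rmorphN rmorphXn /= ff_res_symbN1.
(* The terms in g_n^(j-1) add up to a multiple of delta u - 2. *)
have du := delta_symbN1 hk hdelta K.
transitivity (- ff_res (fbase_hom K) delta * g j K q
  + (ff_res (fbase_hom K) delta * u K - 2) * (u K ^+ m * gprev g j K q)).
  by rewrite exprS; ring.
by rewrite du subrr mul0r addr0.
Qed.

(** The 1-shifts of both sides are compared. The one of g_n^(j+1) is not part of the
    defining recursion and is computed from its (-1)-shift g_n^j. *)
Lemma tilde_gfamily_even j : ~~ odd j ->
  tilde_op (g j) = inv_scale (u (fbase k) ^+ m) (gprev g j) ->
  tilde_op (g j.+1) = inv_scale (- delta) (g j.+1) ->
  tilde_op (g j.+2) = inv_scale (u (fbase k) ^+ m) (g j.+1).
Proof.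
move=> j_even Tj TjS; have [_ _ gS0 _ _] := hg.
have [si hs] := shift_ex (ltn0Sn m) (tilde_op (g j.+2)) (gsignP j.+1).
have [be' hb'] := shift_ex (ltn0Sn m) (g j.+1) (gsignP j.+1).
apply: (inv_eq_shift hk (ltn0Sn m) (gsignP j.+1) hs); last first.
  by move=> K; rewrite tilde_at0 /= gS0 mulr0.
suff -> : si = inv_scale (u (fbase k) ^+ m) be' by apply: shift_scale.
apply: inv_ext => K q; rewrite (shift_tilde_gfamily hs) TjS /= Tj.
rewrite gsignS in hb'; rewrite (gfamily_opposite_shift hb').
rewrite gsignS /gsign (negbTE j_even) /= !rmorphN rmorphXn /= ff_res_symbN1.
ring.
Qed.

End TildeGFamily.

Theorem proposition1p2p65 (k : fieldType) (hk : 2%N \notin [pchar k])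
    (A : pfister_functor k)
    (delta : A (fbase k)) (hdelta : is_delta delta)
    (n : nat) (hn : (1 <= n)%N)
    (g : nat -> InvI A n) (hg : is_gfamily g) (d : nat) :
  tilde_op (g d) =
    if odd d then inv_scale (- delta) (g d)
    else inv_scale (symb A (nzN (nz1 (fbase k))) ^+ n.-1) (gprev g d).
Proof.
case: n hn g hg => // m _ g hg /=; have [_ g0 _ _ _] := hg.
suff E j : tilde_op (g j.*2)
      = inv_scale (symb A (nzN (nz1 (fbase k))) ^+ m) (gprev g j.*2)
    /\ tilde_op (g j.*2.+1) = inv_scale (- delta) (g j.*2.+1).
  have := odd_double_half d; have [E0 E1] := E d./2.
  by case: (odd d) => dE; rewrite -dE ?add1n ?add0n.
have double_even i : ~~ odd i.*2 by rewrite odd_double.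
elim: j => [|j [IH0 IH1]].
  have T0 : tilde_op (g 0)
      = inv_scale (symb A (nzN (nz1 (fbase k))) ^+ m) (gprev g 0).
    by rewrite g0 tilde_const /= scale_const0.
  split=> //; apply: (tilde_gfamily_odd hk hdelta hg) => //.
  by rewrite /= tilde_const scale_const0.
have T2 := tilde_gfamily_even hk hdelta hg (double_even j) IH0 IH1.
rewrite doubleS; split=> //.
by apply: (tilde_gfamily_odd hk hdelta hg (double_even j.+1)).
Qed.
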